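(* Let $\Omega\subset B_R^d\subset\mathbb{R}^d$ be a smooth compact manifold without boundary, of dimension $k<d$, equipped with an atlas $(\Psi_j,U_j)_{j\in[T]}$ as in the context, such that there exists $Q>0$ with $$\sup_{u\in B_{r_j}^k}\|D^\alpha\Psi_j^{-1}(u)\|\le Q^{|\alpha|}\qquad\text{for all nonzero multi-indices }\alpha\in\mathbb{N}_0^k\text{ and all }j\in[T].$$ Fix $\eta>0$. Let $X\subset\Omega$ be a set of cardinality $n\in\mathbb{N}$. Then: 1. Let $h_{X,\Omega}=\sup_{x'\in\Omega}\inf_{x\in X}\|x-x'\|$, and let $\mathcal{H}$ be the reproducing kernel Hilbert space associated to the Gaussian kernel $k_\eta$. There exist $c,h>0$, not depending on $X$ or $n$, such that whenever $h_{X,\Omega}\le h$, $$|f(x)-\widehat f_X(x)|\le e^{-c\,h_{X,\Omega}^{-2/5}}\,\|f\|_{\mathcal H}\qquad\text{for all }f\in\mathcal H,\ x\in\Omega .$$ 2. Let $K$ be the Gaussian kernel matrix of $X$. There exists a constant $c>0$, not depending on $X$ or $n$, such that $$\lambda_{p+1}(K)\le n\,e^{-c\,p^{2/(5k)}}\qquad\text{for all }p\in[n].$$ 3. Let $\tau\in(0,1]$ and let $d_{\mathrm{eff}}(\tau)$ be the effective dimension computed on $K$. There exist constants $c_1,c_2$, not depending on $X$, $n$ or $\tau$, such that $$d_{\mathrm{eff}}(\tau)\le\Big(c_1\log\frac1\tau\Big)^{5k/2}+c_2 .$$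
   Context: $[m]=\{1,\dots,m\}$. $B_\rho^m$ denotes the ball of radius $\rho$ centered at the origin of $\mathbb{R}^m$. Atlas: $T\in\mathbb{N}$; $(U_j)_{j\in[T]}$ are open sets covering $\Omega$, and each $\Psi_j:U_j\to B_{r_j}^k$ is a smooth bijection with smooth inverse. For $\alpha\in\mathbb{N}_0^k$, $|\alpha|=\sum_i\alpha_i$ and $D^\alpha=\frac{\partial^{|\alpha|}}{\partial u_1^{\alpha_1}\cdots\partial u_k^{\alpha_k}}$. The Gaussian kernel is $k_\eta(x,x')=e^{-\eta\|x-x'\|^2}$ on $\mathbb{R}^d$. For $X=\{x_1,\dots,x_n\}$ the Gaussian kernel matrix is $K_{ij}=k_\eta(x_i,x_j)$. For $f:\mathbb{R}^d\to\mathbb{R}$, $\widehat f_X(x)=\sum_{i=1}^nc_i\,k_\eta(x,x_i)$ with $(c_1,\dots,c_n)^\top=K^{-1}(f(x_1),\dots,f(x_n))^\top$. $\lambda_j(K)$ is the $j$-th largest eigenvalue of $K$ ($\lambda_j(K)=0$ for $j>n$), and $d_{\mathrm{eff}}(\tau)=\sum_{j=1}^n\frac{\lambda_j(K)}{\lambda_j(K)+\tau n}$. The constants may depend on $\Omega$ and its atlas, $\eta$, $d$, $k$, $R$, $Q$. *)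

(* Defs.v *)
From mathcomp Require Import all_boot all_order all_algebra.
From mathcomp Require Import all_classical all_reals all_analysis.
From mathcomp Require Import polyrcf.

Set Implicit Arguments.
Unset Strict Implicit.
Unset Printing Implicit Defensive.
Import Order.TTheory GRing.Theory Num.Theory.
Import numFieldNormedType.Exports.
Local Open Scope classical_set_scope.
Local Open Scope ring_scope.

(* The library norm `|x| on 'rV[R]_m is the sup norm (with the usual topology),
   hence a separate Euclidean norm. *)
Definition enorm (R : realType) (m : nat) (x : 'rV[R]_m) : R :=
  Num.sqrt (\sum_(i < m) x 0 i ^+ 2).

Definition open_eball (R : realType) (m : nat) (rho : R) : set 'rV[R]_m :=
  [set x | enorm x < rho].

Definition closed_eball (R : realType) (m : nat) (rho : R) : set 'rV[R]_m :=
  [set x | enorm x <= rho].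

Definition partial (R : realType) (m l : nat) (i : 'I_m)
    (f : 'rV[R]_m -> 'rV[R]_l) : 'rV[R]_m -> 'rV[R]_l :=
  fun x => 'D_(delta_mx 0 i) f x.

Definition iter_partial (R : realType) (m l : nat) (s : seq 'I_m)
    (f : 'rV[R]_m -> 'rV[R]_l) : 'rV[R]_m -> 'rV[R]_l :=
  foldr (fun i g => partial i g) f s.

Definition mindex_size (k : nat) (alpha : {ffun 'I_k -> nat}) : nat :=
  (\sum_(i < k) alpha i)%N.

Definition mderive (R : realType) (k l : nat) (alpha : {ffun 'I_k -> nat})
    (f : 'rV[R]_k -> 'rV[R]_l) : 'rV[R]_k -> 'rV[R]_l :=
  iter_partial (flatten [seq nseq (alpha i) i | i <- enum 'I_k]) f.

(* C^infinity on an open set W: the iterated partial derivatives of all orders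
   exist and are continuous on W. *)
Definition smooth_on_open (R : realType) (m l : nat) (W : set 'rV[R]_m)
    (f : 'rV[R]_m -> 'rV[R]_l) : Prop :=
  forall (s : seq 'I_m) (x : 'rV[R]_m), W x ->
    {for x, continuous (iter_partial s f)} /\
    (forall i : 'I_m, derivable (iter_partial s f) x (delta_mx 0 i)).

(* Smoothness on an arbitrary subset of R^m: f locally extends to a smooth map
   on an open set. Values of f outside A are irrelevant. *)
Definition smooth_on (R : realType) (m l : nat) (A : set 'rV[R]_m)
    (f : 'rV[R]_m -> 'rV[R]_l) : Prop :=
  forall x, A x -> exists (W : set 'rV[R]_m) (F : 'rV[R]_m -> 'rV[R]_l),
    [/\ open W, W x, smooth_on_open W F &
        forall y, A y -> W y -> F y = f y].

Definition diffeo (R : realType) (m l : nat)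
    (A : set 'rV[R]_m) (B : set 'rV[R]_l)
    (f : 'rV[R]_m -> 'rV[R]_l) (g : 'rV[R]_l -> 'rV[R]_m) : Prop :=
  [/\ smooth_on A f, smooth_on B g,
      forall x, A x -> B (f x) /\ g (f x) = x &
      forall y, B y -> A (g y) /\ f (g y) = y].

Definition rel_open (R : realType) (m : nat) (A U : set 'rV[R]_m) : Prop :=
  exists O : set 'rV[R]_m, open O /\ U = A `&` O.

Definition smooth_manifold (R : realType) (d k : nat) (Omega : set 'rV[R]_d)
    : Prop :=
  forall p, Omega p ->
  exists (U : set 'rV[R]_d) (V : set 'rV[R]_k)
         (f : 'rV[R]_d -> 'rV[R]_k) (g : 'rV[R]_k -> 'rV[R]_d),
    [/\ rel_open Omega U, U p, open V & diffeo U V f g].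

(* Charts of a k-dimensional manifold cannot be open in R^d for k < d: the U j
   are open in the subspace topology of Omega. Psi_inv j represents the inverse
   of Psi j : U j -> B_(r j). *)
Definition ball_atlas (R : realType) (d k : nat) (Omega : set 'rV[R]_d)
    (T : nat) (U : 'I_T -> set 'rV[R]_d) (r : 'I_T -> R)
    (Psi : 'I_T -> 'rV[R]_d -> 'rV[R]_k)
    (Psi_inv : 'I_T -> 'rV[R]_k -> 'rV[R]_d) : Prop :=
  [/\ forall j, rel_open Omega (U j),
      Omega `<=` \bigcup_j U j,
      forall j, 0 < r j &
      forall j, diffeo (U j) (open_eball (r j)) (Psi j) (Psi_inv j)].

Definition gaussian (R : realType) (d : nat) (eta : R) (x y : 'rV[R]_d) : R :=
  expR (- eta * enorm (x - y) ^+ 2).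

Definition gaussian_mx (R : realType) (d n : nat) (eta : R)
    (x : 'I_n -> 'rV[R]_d) : 'M[R]_n :=
  \matrix_(i, j) gaussian eta (x i) (x j).

Definition interpolant (R : realType) (d n : nat) (eta : R)
    (x : 'I_n -> 'rV[R]_d) (f : 'rV[R]_d -> R) (y : 'rV[R]_d) : R :=
  let c := invmx (gaussian_mx eta x) *m (\col_i f (x i)) in
  \sum_(i < n) c i 0 * gaussian eta y (x i).

(* Only the values of dot on car are meaningful. *)
Record rkhs (R : realType) (E : Type) (ker : E -> E -> R) := RKHS {
  car : set (E -> R) ;
  dot : (E -> R) -> (E -> R) -> R ;
  rkhs0 : car (fun=> 0) ;
  rkhs_lin : forall (a : R) f g, car f -> car g ->
    car (fun x => a * f x + g x) ;
  dot_sym : forall f g, car f -> car g -> dot f g = dot g f ;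
  dot_lin : forall (a : R) f g h, car f -> car g -> car h ->
    dot (fun x => a * f x + g x) h = a * dot f h + dot g h ;
  dot_ge0 : forall f, car f -> 0 <= dot f f ;
  dot_eq0 : forall f, car f -> dot f f = 0 -> f = (fun=> 0) ;
  rkhs_complete : forall u : nat -> E -> R, (forall n, car (u n)) ->
    (forall e : R, 0 < e -> exists N : nat, forall m n : nat,
       (N <= m)%N -> (N <= n)%N ->
       Num.sqrt (dot (fun x => u m x - u n x) (fun x => u m x - u n x)) < e) ->
    exists2 f, car f & forall e : R, 0 < e ->
      exists N : nat, forall n : nat, (N <= n)%N ->
        Num.sqrt (dot (fun x => u n x - f x) (fun x => u n x - f x)) < e ;
  rkhs_ker : forall x, car (ker x) ;
  rkhs_reproducing : forall f x, car f -> dot f (ker x) = f x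
}.

Definition rkhs_norm (R : realType) (E : Type) (ker : E -> E -> R)
    (H : rkhs ker) (f : E -> R) : R := Num.sqrt (dot H f f).

(* h_{X,Omega}; the real sup and inf are the true ones when X and Omega are
   nonempty and Omega is bounded. *)
Definition fill_distance (R : realType) (d : nat) (X Omega : set 'rV[R]_d) : R :=
  sup [set inf [set enorm (x - x') | x in X] | x' in Omega].

(* Real eigenvalues repeated according to their algebraic multiplicity, in
   nonincreasing order; for symmetric A these are all n eigenvalues. *)
Definition eigenvalues (R : realType) (n : nat) (A : 'M[R]_n) : seq R :=
  sort >=%R (flatten [seq nseq (mup a (char_poly A)) a
                     | a <- rootsR (char_poly A)]).

(* j-th largest eigenvalue, with j counted from 1; it is 0 for j > n. *)
Definition eig (R : realType) (n : nat) (A : 'M[R]_n) (j : nat) : R :=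
  nth 0 (eigenvalues A) j.-1.

Definition eff_dim (R : realType) (n : nat) (A : 'M[R]_n) (tau : R) : R :=
  \sum_(1 <= j < n.+1) eig A j / (eig A j + tau * n%:R).

(* Main.v *)
Require Import Defs.
From mathcomp Require Import all_boot all_order all_algebra.
From mathcomp Require Import all_classical all_reals all_analysis.
From mathcomp Require Import polyrcf complex.
From mathcomp Require Import zify ring lra.

Set Implicit Arguments.
Unset Strict Implicit.
Unset Printing Implicit Defensive.
Import Order.TTheory GRing.Theory Num.Theory.
Import numFieldNormedType.Exports.
Local Open Scope classical_set_scope.
Local Open Scope ring_scope.

(* Restricting a function of the native space to a chart and to lines parallel to
   the axes gives functions of one variable that are uniform limits of polynomials
   with coefficients bounded as for a holomorphic function on a fixed disc.
   Extrapolating from 2N+1 equispaced nodes centred at a point, the value at a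
   neighbour at distance theta (in units of the spacing) uses weights that differ
   from those of the central node by O(theta sqrt N) in total.  If g vanishes on a
   delta-dense set, moving from a point to a zero of g along the axes therefore
   divides sup |g| on a slightly smaller box by 4, up to an error exponentially
   small in N.  Shrinking a fixed box by N steps of size 1/N is possible as long as
   N^(5/2) delta is small, and gives |g| <= C 4^-N ||g|| at the centre; with
   N = delta^(-2/5) this is the interpolation error applied to g = f - interpolant.
   Interpolating the kernel itself on a net of p points of Omega of fill distance
   p^(-1/k) yields a rank p approximation of K, hence the eigenvalue bound, and
   summing the eigenvalue bound yields the effective dimension. *)

(** * Uniform limits of polynomials with bounded coefficient norm *)

(** The regularity of g enters only through the kernel. The error of extrapolating g is a finite
    functional applied to g, and its native norm is a quadratic form in kernel values;
    [native_bounded] transfers that norm to g. Hence only the explicit functions s -> k(x, gamma(s))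
    have to be expanded, with constants uniform in x, and one argument serves both the elements of
    an RKHS and the kernel residuals behind the eigenvalue bound, for which no Hilbert space has to
    be constructed. The obstacle is that X is scattered and contains no grid, so nothing can be
    interpolated from values of g at its zeros. The extrapolation nodes are therefore arbitrary
    points of axis-parallel segments, at which g merely obeys the bound of the previous step; a zero
    enters only as the end of a short path. This fixes the exponent. A box of fixed size is shared
    by N steps, and every step must fit N nodes on either side, so the spacing is of order N^-2 and
    theta is of order N^2 delta; smallness of theta sqrt N is smallness of N^(5/2) delta. *)

Definition pnorm (R : realType) (rho : R) (p : {poly R}) : R :=
  \sum_(i < size p) `|p`_i| * rho ^+ i.

Lemma pnorm_wide (R : realType) (rho : R) (p : {poly R}) n :
  (size p <= n)%N -> pnorm rho p = \sum_(i < n) `|p`_i| * rho ^+ i.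
Proof.
move=> pn; rewrite /pnorm -!(big_mkord xpredT (fun i => `|p`_i| * rho ^+ i)).
rewrite [RHS](@big_cat_nat _ _ _ (size p)) //= [X in _ + X]big_nat_cond [X in _ + X]big1 ?addr0 //.
by move=> i /andP[/andP[pi _] _]; rewrite nth_default // normr0 mul0r.
Qed.

Lemma pnorm_ge0 (R : realType) (rho : R) p : 0 <= rho -> 0 <= pnorm rho p.
Proof. by move=> r0; apply: sumr_ge0 => i _; rewrite mulr_ge0 // exprn_ge0. Qed.

Lemma pnormD (R : realType) (rho : R) p q : 0 <= rho ->
  pnorm rho (p + q) <= pnorm rho p + pnorm rho q.
Proof.
move=> r0; set n := maxn (size p) (size q).
rewrite (@pnorm_wide _ _ _ n) ?size_polyD // (@pnorm_wide _ _ p n) ?leq_maxl //.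
rewrite (@pnorm_wide _ _ q n) ?leq_maxr // -big_split /= ler_sum // => i _.
by rewrite coefD -mulrDl ler_wpM2r ?exprn_ge0 // ler_normD.
Qed.

Lemma pnormC (R : realType) (rho c : R) : pnorm rho c%:P = `|c|.
Proof.
by rewrite (@pnorm_wide _ _ _ 1) ?size_polyC_leq1 // big_ord1 coefC eqxx expr0 mulr1.
Qed.

Lemma pnorm_sum (R : realType) (rho : R) n (F : 'I_n -> {poly R}) : 0 <= rho ->
  pnorm rho (\sum_i F i) <= \sum_i pnorm rho (F i).
Proof.
move=> r0; elim/big_ind2: _ => [|x a y b xa yb|//].
  by rewrite pnormC normr0.
by rewrite (le_trans (pnormD _ _ r0)) // lerD.
Qed.

Lemma pnormXn (R : realType) (rho c : R) n (q : {poly R}) : 0 <= rho ->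
  pnorm rho (c *: 'X^n * q) <= `|c| * rho ^+ n * pnorm rho q.
Proof.
move=> r0.
have sz : (size (c *: 'X^n * q)%R <= n + size q)%N.
  rewrite -scalerAl (leq_trans (size_scale_leq _ _)) //.
  by rewrite (leq_trans (size_polyMleq _ _)) // size_polyXn.
rewrite (pnorm_wide rho sz) big_split_ord /= big1 ?add0r.
  rewrite /pnorm mulr_sumr ler_sum // => i _.
  rewrite -scalerAl coefZ coefXnM ltnNge leq_addr /= addKn normrM exprD.
  by rewrite mulrACA.
by move=> i _; rewrite -scalerAl coefZ coefXnM ltn_ord mulr0 normr0 mul0r.
Qed.

(** The weighted l^1 norm is chosen because it is submultiplicative and also controls the tail of
    degree at least n; the sup norm on a real segment does not control that tail well. *)
Lemma pnormM (R : realType) (rho : R) p q : 0 <= rho ->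
  pnorm rho (p * q) <= pnorm rho p * pnorm rho q.
Proof.
move=> r0; rewrite -{1}[p]coefK poly_def mulr_suml.
rewrite (le_trans (pnorm_sum _ r0)) // {2}/pnorm mulr_suml ler_sum // => i _.
exact: pnormXn.
Qed.

Lemma pnormX (R : realType) (rho : R) p n : 0 <= rho ->
  pnorm rho (p ^+ n) <= pnorm rho p ^+ n.
Proof.
move=> r0; elim: n => [|n IH]; first by rewrite !expr0 pnormC normr1.
by rewrite !exprS (le_trans (pnormM _ _ r0)) // ler_wpM2l ?pnorm_ge0.
Qed.

Lemma pnorm_horner (R : realType) (rho : R) p s : `|s| <= rho -> `|p.[s]| <= pnorm rho p.
Proof.
move=> sr; rewrite horner_coef (le_trans (ler_norm_sum _ _ _)) // ler_sum // => i _.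
by rewrite normrM normrX ler_wpM2l // lerXn2r // nnegrE (le_trans _ sr).
Qed.

(* Stands in for holomorphic functions bounded by M on the disc of radius rho:
   unlike real-analyticity this is stable under products and exp with explicit M. *)
Definition wiener (R : realType) (rho M : R) (F : R -> R) : Prop :=
  forall e : R, 0 < e -> exists2 p : {poly R}, pnorm rho p <= M &
    forall s, `|s| <= rho -> `|F s - p.[s]| <= e.

Lemma wiener_le (R : realType) (rho M M' : R) F :
  M <= M' -> wiener rho M F -> wiener rho M' F.
Proof. by move=> MM W e e0; have [p pM pF] := W e e0; exists p => //; exact: le_trans MM. Qed.

Lemma wiener_bound (R : realType) (rho M : R) F s :
  wiener rho M F -> `|s| <= rho -> `|F s| <= M.
Proof.
move=> W sr; apply/ler_addgt0Pr => e e0; have [p pM pF] := W e e0.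
rewrite -[F s](subrK p.[s]) (le_trans (ler_normD _ _)) // addrC lerD ?pF //.
by rewrite (le_trans _ pM) // pnorm_horner.
Qed.

Lemma wiener_cst (R : realType) (rho c : R) : wiener rho `|c| (fun=> c).
Proof. by move=> e e0; exists c%:P => [|s _]; rewrite ?pnormC // hornerC subrr normr0 ltW. Qed.

Lemma wienerD (R : realType) (rho M N : R) F G : 0 <= rho ->
  wiener rho M F -> wiener rho N G -> wiener rho (M + N) (fun s => F s + G s).
Proof.
move=> r0 WF WG e e0; have e2 : 0 < e / 2 by rewrite divr_gt0.
have [p pM pF] := WF _ e2; have [q qN qG] := WG _ e2; exists (p + q).
  by rewrite (le_trans (pnormD _ _ r0)) // lerD.
move=> s sr; rewrite hornerD opprD addrACA (le_trans (ler_normD _ _)) //.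
by rewrite [leRHS]splitr lerD ?pF ?qG.
Qed.

Lemma wienerM (R : realType) (rho M N : R) F G : 0 <= rho -> 0 <= M -> 0 <= N ->
  wiener rho M F -> wiener rho N G -> wiener rho (M * N) (fun s => F s * G s).
Proof.
move=> r0 M0 N0 WF WG e e0.
have D0 : 0 < M + N + 1 by rewrite ltr_wpDl // addr_ge0.
have e2 : 0 < e / (M + N + 1) by rewrite divr_gt0.
have [p pM pF] := WF _ e2; have [q qN qG] := WG _ e2; exists (p * q).
  by rewrite (le_trans (pnormM _ _ r0)) // ler_pM // pnorm_ge0.
move=> s sr; rewrite hornerM.
have -> : F s * G s - p.[s] * q.[s] = (F s - p.[s]) * G s + p.[s] * (G s - q.[s]) by ring.
rewrite (le_trans (ler_normD _ _)) // !normrM.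
have h1 := wiener_bound WG sr; have h2 := le_trans (pnorm_horner p sr) pM.
apply: (@le_trans _ _ (e / (M + N + 1) * N + M * (e / (M + N + 1)))).
  by rewrite lerD // ler_pM // ?pF ?qG.
rewrite [M * _]mulrC -mulrDr mulrAC ler_pdivrMr // ler_wpM2l //; first exact: ltW.
by rewrite addrC lerDl.
Qed.

Lemma wiener_sum (R : realType) (rho M : R) n (F : 'I_n -> R -> R) : 0 <= rho ->
  (forall i, wiener rho M (F i)) -> wiener rho (n%:R * M) (fun s => \sum_i F i s).
Proof.
move=> r0; elim: n F => [|n IH] F W.
  rewrite mul0r -[X in wiener _ X](normr0 R).
  suff -> : (fun s => \sum_i F i s) = fun=> 0 by exact: wiener_cst.
  by apply/funext => s; rewrite big_ord0.
have -> : (fun s => \sum_i F i s) =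
    fun s => \sum_(i < n) F (widen_ord (leqnSn n) i) s + F ord_max s.
  by apply/funext => s; rewrite big_ord_recr.
by rewrite -natr1 mulrDl mul1r; apply: wienerD => //; apply: IH.
Qed.

(** The upper side comes from e^t (1 - t) <= e^t e^(-t) = 1, divided by 1 - t >= 1/2. *)
Lemma expR_sub1_bound (R : realType) (t : R) : `|t| <= 1/2 -> `|expR t - (1 + t)| <= 2 * t ^+ 2.
Proof.
move=> t1; have /andP[t2 t3] : - (1/2) <= t <= 1/2 by rewrite -ler_norml.
have h1 := expR_ge1Dx t; have h2 := expR_ge1Dx (- t).
rewrite ger0_norm ?subr_ge0 //.
have h3 : expR t * (1 - t) <= 1.
  by rewrite -[leRHS](expRxMexpNx_1 t) ler_wpM2l // expR_ge0.
rewrite -(@ler_pM2r _ (1 - t)); last lra.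
rewrite mulrBl; nra.
Qed.

Lemma exprB_bound (R : realType) (a b c : R) n : `|a| <= c -> `|b| <= c -> 1 <= c ->
  `|a ^+ n - b ^+ n| <= n%:R * c ^+ n * `|a - b|.
Proof.
move=> ac bc c1; have c0 : 0 <= c by rewrite (le_trans _ c1).
elim: n => [|n IH]; first by rewrite !expr0 subrr normr0 !mul0r.
have -> : a ^+ n.+1 - b ^+ n.+1 = a * (a ^+ n - b ^+ n) + (a - b) * b ^+ n.
  by rewrite !exprS; ring.
rewrite (le_trans (ler_normD _ _)) // !normrM -natr1 !mulrDl mul1r lerD //.
  rewrite exprS [_ * (c * _)]mulrCA -mulrA ler_pM //.
rewrite mulrC ler_wpM2r // normrX.
apply: (@le_trans _ _ (c ^+ n)); first by rewrite lerXn2r // nnegrE.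
by rewrite exprS ler_peMl // exprn_ge0.
Qed.

(* exp is approximated by (1 + p / n)^n, whose coefficient norm is at most exp M. *)
Lemma wiener_exp (R : realType) (rho M : R) F : 0 <= rho -> 0 <= M ->
  wiener rho M F -> wiener rho (expR M) (fun s => expR (F s)).
Proof.
move=> r0 M0 WF e e0.
(* [exprB_bound] contributes n e^M, and one factor of the power has error (2 M^2 + 1) / n^2, so the
   total error is K / n. The condition n > 2 M brings F s / n into the range of
   [expR_sub1_bound]. *)
pose K := expR M * (1 + 2 * M ^+ 2).
have K0 : 0 < K by rewrite mulr_gt0 ?expR_gt0 // ltr_pwDl // mulr_ge0 // sqr_ge0.
pose n := (Num.truncn (Num.max (K / e) (2 * M))).+1.
have : Num.max (K / e) (2 * M) < n%:R by rewrite truncnS_gt.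
rewrite gt_max => /andP[nK nM].
have n0 : 0 < n%:R :> R by rewrite ltr0n.
have [p pM pF] := WF n%:R^-1 ltac:(by rewrite invr_gt0).
have bM x : 0 <= x -> x <= M -> (1 + x / n%:R) ^+ n <= expR M.
  move=> x0 xM; rewrite -[M in leRHS](mulfVK (lt0r_neq0 n0)) expRM_natr lerXn2r ?nnegrE ?expR_ge0 //.
    by rewrite addr_ge0 // divr_ge0 // ltW.
  by rewrite (le_trans _ (expR_ge1Dx _)) // lerD2l ler_wpM2r // invr_ge0 ltW.
exists ((1 + n%:R^-1%:P * p) ^+ n).
  rewrite (le_trans (pnormX _ _ r0)) //.
  apply: le_trans (bM _ (pnorm_ge0 p r0) pM).
  rewrite lerXn2r ?nnegrE ?pnorm_ge0 ?addr_ge0 ?divr_ge0 ?pnorm_ge0 ?(ltW n0) //.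
  rewrite (le_trans (pnormD _ _ r0)) // -{1}polyC1 pnormC normr1 lerD2l.
  by rewrite (le_trans (pnormM _ _ r0)) // pnormC ger0_norm ?invr_ge0 ?(ltW n0) // mulrC.
move=> s sr; rewrite horner_exp hornerD hornerM !hornerC.
have FM := wiener_bound WF sr; have qM := le_trans (pnorm_horner p sr) pM.
rewrite {1}(_ : F s = F s / n%:R * n%:R) ?expRM_natr; last by rewrite mulfVK // lt0r_neq0.
pose c := expR (M / n%:R).
have c1 : 1 <= c by rewrite -[leLHS]expR0 ler_expR divr_ge0 // ltW.
have cn : c ^+ n = expR M by rewrite -expRM_natr mulfVK // lt0r_neq0.
have ac : `|expR (F s / n%:R)| <= c.
  rewrite ger0_norm ?expR_ge0 // ler_expR ler_wpM2r ?invr_ge0 ?(ltW n0) //.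
  exact: le_trans (ler_norm _) FM.
have bc : `|1 + n%:R^-1 * p.[s]| <= c.
  rewrite (le_trans (ler_normD _ _)) // normr1 (le_trans _ (expR_ge1Dx _)) // lerD2l.
  by rewrite normrM ger0_norm ?invr_ge0 ?(ltW n0) // mulrC ler_wpM2r // invr_ge0 ltW.
rewrite (le_trans (exprB_bound n ac bc c1)) // cn.
have Fn : `|F s / n%:R| <= 1/2.
  rewrite normrM [`|n%:R^-1|]ger0_norm ?invr_ge0 ?(ltW n0) // ler_pdivrMr //; lra.
have h1 := expR_sub1_bound Fn.
have h2 : `|expR (F s / n%:R) - (1 + n%:R^-1 * p.[s])| <= 2 * (M / n%:R) ^+ 2 + (n%:R^-1) ^+ 2.
  have -> : expR (F s / n%:R) - (1 + n%:R^-1 * p.[s]) =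
    (expR (F s / n%:R) - (1 + F s / n%:R)) + n%:R^-1 * (F s - p.[s]) by ring.
  rewrite (le_trans (ler_normD _ _)) // lerD //.
    rewrite (le_trans h1) // ler_wpM2l // -[X in X <= _]ger0_norm ?sqr_ge0 // normrX.
    rewrite lerXn2r ?nnegrE ?divr_ge0 ?(ltW n0) //.
    by rewrite normrM [`|n%:R^-1|]ger0_norm ?invr_ge0 ?(ltW n0) // ler_wpM2r // invr_ge0 ltW.
  by rewrite normrM [`|n%:R^-1|]ger0_norm ?invr_ge0 ?(ltW n0) // expr2 ler_wpM2l ?invr_ge0 ?(ltW n0) ?pF.
apply: (@le_trans _ _ (K / n%:R)); last first.
  by rewrite ler_pdivrMr // mulrC -ler_pdivrMr // ltW.
apply: (le_trans (ler_wpM2l _ h2)).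
  by rewrite mulr_ge0 ?expR_ge0 // ltW.
rewrite le_eqVlt; apply/orP; left; apply/eqP; rewrite /K; field.
exact: lt0r_neq0.
Qed.

(** A functional that kills degree below n sees only X^n times the quotient [drop_poly n p]. The
    quotient is at most M / rho^n on the disc and X^n is at most sigma^n at the nodes, whence the
    gain (sigma / rho)^n. *)
Lemma wiener_functional (R : realType) (rho sigma M : R) F n m
    (a s : 'I_m -> R) : 0 < rho -> 0 <= M -> sigma <= rho -> wiener rho M F ->
  (forall i, `|s i| <= sigma) ->
  (forall q : {poly R}, (size q <= n)%N -> \sum_i a i * q.[s i] = 0) ->
  `|\sum_i a i * F (s i)| <= (\sum_i `|a i|) * (M * (sigma / rho) ^+ n).
Proof.
move=> r0 M0 sigr W ss kill.
case: m a s ss kill => [|m] a s ss kill; first by rewrite !big_ord0 normr0 mul0r.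
have sig0 : 0 <= sigma by apply: le_trans (ss ord0).
apply/ler_addgt0Pr => e e0.
have A0 : 0 <= \sum_i `|a i| by exact: sumr_ge0.
have [p pM pF] := W (e / (\sum_i `|a i| + 1)) ltac:(by rewrite divr_gt0 // ltr_wpDl).
have -> : \sum_i a i * F (s i) = \sum_i a i * (drop_poly n p * 'X^n).[s i]
     + \sum_i a i * (F (s i) - p.[s i]).
  transitivity (\sum_i a i * F (s i) - \sum_i a i * (take_poly n p).[s i]).
    by rewrite kill ?size_take_poly // subr0.
  rewrite -sumrB -big_split.
  apply: eq_bigr => i _ /=.
  have -> : p.[s i] = (take_poly n p).[s i] + (drop_poly n p * 'X^n).[s i].
    by rewrite -hornerD poly_take_drop.
  ring.
rewrite (le_trans (ler_normD _ _)) // lerD //.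
  rewrite (le_trans (ler_norm_sum _ _ _)) // mulr_suml ler_sum // => i _.
  rewrite normrM ler_wpM2l // hornerM hornerXn normrM.
  have h : pnorm rho (drop_poly n p) * rho ^+ n <= M.
    apply: le_trans pM; rewrite (@pnorm_wide _ rho p (n + size p)%N) ?leq_addl //.
    rewrite big_split_ord /= ler_wpDl //.
      by apply: sumr_ge0 => j _; rewrite mulr_ge0 // exprn_ge0 // ltW.
    rewrite (@pnorm_wide _ rho _ (size p)); last by rewrite size_drop_poly leq_subr.
    rewrite mulr_suml ler_sum // => j _.
    by rewrite coef_drop_poly -mulrA -exprD addnC.
  rewrite expr_div_n mulrA ler_pdivlMr ?exprn_gt0 // mulrAC.
  apply: ler_pM => //; first by rewrite mulr_ge0 // exprn_ge0 // ltW.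
    apply: le_trans h; rewrite ler_wpM2r ?exprn_ge0 ?(ltW r0) //.
    by apply: pnorm_horner; rewrite (le_trans (ss i)).
  by rewrite normrX lerXn2r // nnegrE.
rewrite (le_trans (ler_norm_sum _ _ _)) //.
apply: (@le_trans _ _ (\sum_i `|a i| * (e / (\sum_i `|a i| + 1)))).
  by apply: ler_sum => i _; rewrite normrM ler_wpM2l // pF // (le_trans (ss i)).
rewrite -mulr_suml mulrA ler_pdivrMr; last by rewrite ltr_wpDl.
by rewrite mulrC ler_wpM2l ?(ltW e0) // lerDl.
Qed.

(** The segment from 0 to T is parametrised by [0, 1], which treats both signs of T at once. *)
Lemma mean_value_bound (R : realType) (g dg : R -> R) (T C : R) :
  (forall t : R, 0 <= t <= 1 -> is_derive (t * T) (1 : R) g (dg (t * T))) ->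
  (forall t, 0 <= t <= 1 -> `|dg (t * T)| <= C) ->
  `|g T - g 0| <= C * `|T|.
Proof.
move=> Dg dgC; pose h (t : R) := g (t * T).
have Dh (t : R) : 0 <= t <= 1 -> is_derive t (1 : R) h (T * dg (t * T)).
  move=> t01; have d1 : is_derive t (1 : R) (fun s : R => s * T) T.
    have -> : (fun s : R => s * T) = T *: (@id R) by apply/funext => s; rewrite /= mulrC.
    by apply: is_derive_eq; rewrite [LHS]mulr1.
  have := Dg t t01 => d2.
  have := @is_derive1_comp _ g (fun s => s * T) t _ _ d2 d1.
  by rewrite mulrC.
have [|t|c] := @MVT_segment _ h (fun t => T * dg (t * T)) 0 1 ler01.
- by move=> t; rewrite in_itv /= => /andP[t0 t1]; apply: Dh; rewrite !ltW.
- move: t; apply: derivable_within_continuous => t; rewrite in_itv /= => t01.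
  by have [] := Dh t t01.
rewrite in_itv /= => c01; rewrite subr0 mulr1 /h mul1r mul0r => ->.
by rewrite normrM mulrC ler_wpM2r // dgC.
Qed.

(** Induction by the mean value bound, applied to the shifted family of derivatives. The factor 1 /
    N! of the usual remainder is given up, since Q rho <= 1/2 later makes the bound summable. *)
Lemma taylor_bound (R : realType) (rho B : R) (N : nat) (f : nat -> R -> R) :
  (forall m (s : R), (m < N)%N -> `|s| <= rho -> is_derive s (1 : R) (f m) (f m.+1 s)) ->
  (forall s, `|s| <= rho -> `|f N s| <= B) ->
  forall s, `|s| <= rho ->
    `|f 0%N s - (\poly_(m < N) (f m 0 / m`!%:R)).[s]| <= B * `|s| ^+ N.
Proof.
elim: N f => [|N IH] f df fB s sr.
  by rewrite poly_def big_ord0 horner0 subr0 expr0 mulr1 fB.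
pose P := \poly_(m < N.+1) (f m 0 / m`!%:R).
pose P1 := \poly_(m < N) (f m.+1 0 / m`!%:R).
have dP : P^`() = P1.
  apply/polyP => m; rewrite coef_deriv !coef_poly ltnS; case: ltnP => // mN; last by rewrite mul0rn.
  rewrite factS natrM invfM -[LHS]mulr_natr -mulrA; congr (_ * _).
  by rewrite mulrAC mulVf ?mul1r // pnatr_eq0.
have {}IH t : `|t| <= rho -> `|f 1%N t - P1.[t]| <= B * `|t| ^+ N.
  by apply: (IH (fun m => f m.+1)) => [m u mN|]; [exact: df | exact: fB].
have B0 : 0 <= B by apply: le_trans (fB _ sr).
pose g (t : R) := f 0%N t - P.[t].
have dg t : `|t| <= rho -> is_derive t (1 : R) g (f 1%N t - P1.[t]).
  move=> tr; have := df 0%N t isT tr => d0; rewrite -dP; exact: is_deriveB.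
have g0 : g 0 = 0.
  rewrite /g horner_poly big_ord_recl big1 ?addr0 => [|i _].
    by rewrite /= fact0 divr1 expr0 mulr1 subrr.
  by rewrite expr0n mulr0.
rewrite -[leLHS](_ : `|g s - g 0| = _); last by rewrite g0 subr0.
rewrite exprSr mulrA; apply: (@mean_value_bound _ g (fun t => f 1%N t - P1.[t])).
  move=> t /andP[t0 t1]; apply: dg; rewrite normrM ger0_norm // (le_trans _ sr) //.
  exact: ler_piMl.
move=> t /andP[t0 t1].
have ts : `|t * s| <= `|s| by rewrite normrM ger0_norm // ler_piMl.
rewrite (le_trans (IH _ (le_trans ts sr))) // ler_wpM2l //.
by rewrite lerXn2r // nnegrE.
Qed.

Lemma half_pow_small (R : realType) (e : R) : 0 < e -> exists N : nat, (1/2) ^+ N <= e.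
Proof.
move=> e0; exists (Num.truncn e^-1).+1.
have h : e^-1 < (Num.truncn e^-1).+1%:R by rewrite truncnS_gt.
have n0 : 0 < (Num.truncn e^-1).+1%:R :> R by rewrite ltr0n.
apply: (@le_trans _ _ ((Num.truncn e^-1).+1%:R)^-1).
  rewrite expr_div_n expr1n mul1r lef_pV2 ?posrE ?exprn_gt0 //.
  by rewrite -natrX ler_nat ltnW // ltn_expl.
by rewrite -[leRHS]invrK lef_pV2 ?posrE ?invr_gt0 // ltW.
Qed.

(** The Taylor term of order m >= 1 has size at most (Q rho)^m <= 2^-m, and these sum to at most 1,
    the summand added to A. Order 0 is bounded separately because the derivative bounds concern
    nonzero orders only. *)
Lemma wiener_taylor (R : realType) (rho A Q : R) (f : nat -> R -> R) :
  0 < rho -> 0 < Q -> Q * rho <= 1/2 ->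
  (forall m (s : R), `|s| <= rho -> is_derive s (1 : R) (f m) (f m.+1 s)) ->
  (forall m s, (0 < m)%N -> `|s| <= rho -> `|f m s| <= Q ^+ m) ->
  `|f 0%N 0| <= A -> wiener rho (A + 1) (f 0%N).
Proof.
move=> r0 Q0 Qr df fQ fA e e0; have [N hN] := half_pow_small e0.
have geo n : \sum_(i < n) (1/2 : R) ^+ i.+1 <= 1 - (1/2) ^+ n.
  elim: n => [|n IH]; first by rewrite big_ord0 expr0 subrr.
  rewrite big_ord_recr /= (le_trans (lerD IH (lexx _))) // exprS.
  lra.
have z0 : `|0 : R| <= rho by rewrite normr0 ltW.
exists (\poly_(m < N.+1) (f m 0 / m`!%:R)).
  rewrite (pnorm_wide _ (size_poly _ _)) big_ord_recl expr0 mulr1 coef_poly /= fact0 divr1.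
  rewrite lerD //.
  apply: (@le_trans _ _ (\sum_(i < N) (1/2 : R) ^+ i.+1)).
    apply: ler_sum => i _; rewrite coef_poly /bump leq0n add1n ltnS ltn_ord.
    apply: (@le_trans _ _ (Q ^+ i.+1 * rho ^+ i.+1)).
      rewrite ler_wpM2r ?exprn_ge0 ?(ltW r0) // normrM.
      apply: (@le_trans _ _ (Q ^+ i.+1 * 1)); last by rewrite mulr1.
      rewrite ler_pM // ?fQ // ger0_norm ?invr_ge0 // invf_le1 ?ltr0n ?fact_gt0 //.
      by rewrite ler1n fact_gt0.
    rewrite -exprMn lerXn2r ?nnegrE ?divr_ge0 //.
    by rewrite mulr_ge0 // ltW.
  by rewrite (le_trans (geo N)) // lerBlDr lerDl exprn_ge0 // divr_ge0.
move=> s sr.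
have h := @taylor_bound _ rho (Q ^+ N.+1) N.+1 f (fun m t _ => df m t)
  (fun t => fQ N.+1 t isT) s sr.
rewrite (le_trans h) //.
rewrite -exprMn (le_trans _ hN) //.
apply: (@le_trans _ _ ((1/2) ^+ N.+1)).
  rewrite lerXn2r ?nnegrE ?divr_ge0 ?mulr_ge0 ?(ltW Q0) // (le_trans _ Qr) //.
  by rewrite ler_wpM2l // ltW.
by rewrite exprS ler_piMl ?exprn_ge0 // ?divr_ge0 //; lra.
Qed.

(** * Extrapolation from equispaced nodes *)

Lemma harmonic_le_sqrt (R : realType) N :
  \sum_(i < N) (i.+1%:R)^-1 <= 2 * Num.sqrt (N%:R : R).
Proof.
elim: N => [|N IH]; first by rewrite big_ord0 mulr_ge0 // sqrtr_ge0.
rewrite big_ord_recr /= (le_trans (lerD IH (lexx _))) //.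
set a := Num.sqrt N%:R; set b := Num.sqrt N.+1%:R.
have a0 : 0 <= a by exact: sqrtr_ge0.
have b1 : 1 <= b by rewrite -[leLHS]sqrtr1 ler_sqrt // ler1n.
have a2 : a ^+ 2 = N%:R by rewrite sqr_sqrtr.
have b2 : b ^+ 2 = N%:R + 1 by rewrite sqr_sqrtr // natr1.
have ab : a <= b by rewrite ler_sqrt // ler_nat.
rewrite -[N.+1%:R]natr1 -b2.
have b0 : 0 < b by apply: lt_le_trans b1.
rewrite -(ler_pM2r (exprn_gt0 2 b0)) mulrDl mulVf ?expf_neq0 ?lt0r_neq0 //.
have h : (b - a) * (b + a) = 1 by rewrite -subr_sqr a2 b2; ring.
have h2 : 1 <= 2 * b * (b - a) by nra.
nra.
Qed.

Lemma prod_dist_ord (R : realType) J m :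
  \prod_(i < J + m.+1 | i != J :> nat) `|J%:R - i%:R : R| = J`!%:R * m`!%:R.
Proof.
rewrite big_split_ord /=; congr (_ * _).
  rewrite (eq_bigl xpredT) => [|i]; last by rewrite ltn_eqF // ltn_ord.
  rewrite -[J in RHS]/(J) -(ffactnn J) ffact_prod natr_prod; apply: eq_bigr => i _.
  by rewrite -natrB ?normr_nat // ltnW // ltn_ord.
rewrite big_mkcond big_ord_recl /= addn0 eqxx mul1r.
rewrite fact_prod big_add1 /= big_mkord natr_prod; apply: eq_bigr => i _.
rewrite /bump leq0n add1n -[X in _ != X]addn0 eqn_add2l /= natrD opprD addrA subrr sub0r.
by rewrite normrN normr_nat.
Qed.

Lemma sum_inv_dist_ord (R : realType) N :
  \sum_(i < N + N.+1 | i != N :> nat) `|i%:R - N%:R : R|^-1 <= 4 * Num.sqrt N%:R.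
Proof.
rewrite big_split_ord /=.
rewrite (eq_bigl xpredT) => [|i]; last by rewrite ltn_eqF // ltn_ord.
have -> : \sum_(i < N) `|i%:R - N%:R : R|^-1 = \sum_(i < N) (i.+1%:R)^-1.
  rewrite (reindex_inj rev_ord_inj); apply: eq_bigr => i _ /=.
  by rewrite distrC natrB // opprB addrC subrK normr_nat.
rewrite [X in _ + X]big_mkcond [X in _ + X]big_ord_recl /= addn0 eqxx add0r.
have -> : \sum_(i < N) (if N + bump 0 i != N then `|(N + bump 0 i)%:R - N%:R|^-1 else 0) =
    \sum_(i < N) (i.+1%:R)^-1 :> R.
  apply: eq_bigr => i _.
  rewrite /bump leq0n add1n -[X in _ != X]addn0 eqn_add2l /= natrD addrAC subrr add0r.
  by rewrite normr_nat.
by have := harmonic_le_sqrt R N; lra.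
Qed.

(** J! m! is the denominator of the Lagrange weight of node J ([prod_dist_ord]). Moving one place
    away from the centre replaces a factor N - j by N + j + 1, so the central value N!^2 bounds all
    denominators from below. *)
Lemma fact_central_le N J m : (J + m = N + N)%N -> (N`! * N`! <= J`! * m`!)%N.
Proof.
have key j : (j <= N)%N -> (N`! * N`! <= (N + j)`! * (N - j)`!)%N.
  elim: j => [|j IH] jN; first by rewrite addn0 subn0.
  rewrite (leq_trans (IH (ltnW jN))) // -(subnSK jN) addnS !factS.
  rewrite mulnCA -mulnA leq_mul //; lia.
move=> JmN; have [NJ|JN] := leqP N J.
  have -> : J = (N + (J - N))%N by rewrite subnKC.
  have -> : m = (N - (J - N))%N by lia.
  by apply: key; lia.
rewrite [leqRHS]mulnC.
have -> : m = (N + (N - J))%N by lia.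
rewrite -{2}(subKn (ltnW JN)).
by apply: key; lia.
Qed.

Lemma lagrange_interpolation (F : fieldType) n (x : 'I_n -> F) (q : {poly F}) (t : F) :
  injective x -> (size q <= n)%N ->
  q.[t] = \sum_j (\prod_(i < n | i != j) ((t - x i) / (x j - x i))) * q.[x j].
Proof.
move=> xI sq.
pose l j := \prod_(i < n | i != j) ((x j - x i)^-1 *: ('X - (x i)%:P)).
have lE j s : (l j).[s] = \prod_(i < n | i != j) ((s - x i) / (x j - x i)).
  by rewrite horner_prod; apply: eq_bigr => i _; rewrite hornerZ hornerXsubC mulrC.
have ls j : (size (l j) <= n)%N.
  apply: (@leq_trans (\sum_(i < n | i != j) 1).+1).
    rewrite (leq_trans (size_prod_leq _ _)) // leq_subLR.
    rewrite sum1_card addnS ltnS -sum1_card -big_split /=.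
    by apply: leq_sum => i _; rewrite (leq_trans (size_scale_leq _ _)) // size_XsubC.
  by rewrite sum1_card cardC1 card_ord; case: (n) j => [[]|].
suff qE : q = \sum_j q.[x j] *: l j.
  by rewrite {1}qE horner_sum; apply: eq_bigr => j _; rewrite hornerZ lE mulrC.
apply/eqP; rewrite -subr_eq0; apply/eqP.
apply: (@roots_geq_poly_eq0 _ _ (map x (enum 'I_n))).
- apply/allP => _ /mapP[i _ ->]; rewrite /root hornerD hornerN horner_sum (bigD1 i) //=.
  rewrite hornerZ lE big1 => [|k ki]; last by rewrite divff // subr_eq0 (inj_eq xI) eq_sym.
  rewrite mulr1 big1 ?addr0 ?subrr // => k ki; rewrite hornerZ lE.
  by rewrite (bigD1 i) 1?eq_sym //= subrr !mul0r mulr0.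
- by rewrite map_inj_uniq // enum_uniq.
- rewrite size_map size_enum_ord (leq_trans (size_polyD _ _)) // geq_max sq size_polyN.
  rewrite (leq_trans (size_sum _ _ _)) //; apply/bigmax_leqP => j _.
  by rewrite (leq_trans (size_scale_leq _ _)).
Qed.

(* The j-th Lagrange weight is at most 2 |theta| / |j - N|; the harmonic sum of
   these is bounded by 4 sqrt N, which is all the exponent 5/2 requires. *)
Lemma extrapolation_weights (R : realType) N (theta : R) :
  `|theta| * Num.sqrt N%:R <= 1 / 8 ->
  exists a : 'I_(N + N.+1) -> R,
    (forall q : {poly R}, (size q <= N + N.+1)%N ->
       q.[theta] = \sum_j a j * q.[j%:R - N%:R]) /\
    \sum_j `|a j - (j == N :> nat)%:R| <= 16 * (`|theta| * Num.sqrt N%:R).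
Proof.
move=> ht; pose x (i : 'I_(N + N.+1)) : R := i%:R - N%:R.
have xI : injective x.
  by move=> i j /(congr1 (fun z => z + N%:R)); rewrite !subrK => /eqP; rewrite eqr_nat => /eqP /val_inj.
pose a j := \prod_(i | i != j) ((theta - x i) / (x j - x i)).
have exact (q : {poly R}) : (size q <= N + N.+1)%N -> q.[theta] = \sum_j a j * q.[x j].
  exact: lagrange_interpolation.
exists a; split=> //.
pose o : 'I_(N + N.+1) := rshift N ord0.
have oE : o = N :> nat by rewrite /= addn0.
have xo : x o = 0 by rewrite /x oE subrr.
have eo (i : 'I_(N + N.+1)) : (i == N :> nat) = (i == o) by rewrite -val_eqE /= addn0.
have D0 : 0 < N`!%:R * N`!%:R :> R by rewrite mulr_gt0 // ltr0n fact_gt0.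
have ho : \prod_(i | i != o) `|x i| = N`!%:R * N`!%:R.
  rewrite -prod_dist_ord; apply: eq_big => i; first by rewrite eo.
  by move=> _; rewrite /x distrC.
have hsum : \sum_(i | i != o) `|x i|^-1 <= 4 * Num.sqrt N%:R.
  by apply: le_trans (sum_inv_dist_ord R N); rewrite [leRHS](eq_bigl (fun i => i != o)) // => i; rewrite eo.
have x0 i : i != o -> 0 < `|x i|.
  by move=> io; rewrite normr_gt0 -xo (inj_eq xI).
have aj j : j != o -> `|a j| <= 2 * `|theta| * `|x j|^-1.
  move=> jo.
  have den : N`!%:R * N`!%:R <= \prod_(i | i != j) `|x j - x i|.
    have jN : (j + (N + N - j) = N + N)%N by rewrite subnKC // -ltnS -addnS ltn_ord.
    rewrite (_ : \prod_(i | _) _ = j`!%:R * (N + N - j)`!%:R).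
      by rewrite -!natrM ler_nat fact_central_le.
    have eN : (j + (N + N - j).+1 = N + N.+1)%N by rewrite addnS jN addnS.
    rewrite -prod_dist_ord eN; apply: eq_big => // i _.
    by rewrite /x opprB addrA subrK.
  (* The central node contributes the factor |theta|. Elsewhere |theta - x_i| <= |x_i| (1 + |theta|
     / |x_i|): the |x_i| multiply to N!^2 / |x_j|, and the brackets to at most exp (1/2) <= 2. *)
  have num : \prod_(i | i != j) `|theta - x i| <= `|theta| * (`|x j|^-1 * (N`!%:R * N`!%:R) * 2).
    rewrite (bigD1 o) /= 1?eq_sym // xo subr0 ler_wpM2l //.
    apply: (@le_trans _ _ (\prod_(i | (i != j) && (i != o)) (`|x i| * (1 + `|theta| / `|x i|)))).
      apply: ler_prod => i /andP[_ io]; rewrite normr_ge0 /= mulrDr mulr1 mulrCA divff ?mulr1; last first.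
        exact/lt0r_neq0/x0.
      by rewrite [leRHS]addrC ler_normB.
    rewrite big_split /=; apply: ler_pM.
    - by apply: prodr_ge0.
    - by apply: prodr_ge0 => i _; rewrite addr_ge0 // divr_ge0.
    - rewrite -ho [in leRHS](bigD1 j) //= mulKf ?lt0r_neq0 ?x0 //.
      by rewrite le_eqVlt (eq_bigl (fun i => (i != o) && (i != j))) ?eqxx // => i; rewrite andbC.
    apply: (@le_trans _ _ (expR (\sum_(i | i != o) `|theta| / `|x i|))).
      rewrite expR_sum [leRHS](bigD1 j) //=.
      apply: (@le_trans _ _ (\prod_(i | (i != o) && (i != j)) expR (`|theta| / `|x i|))).
        rewrite (eq_bigl (fun i => (i != o) && (i != j))); last by move=> i; rewrite andbC.
        by apply: ler_prod => i _; rewrite expR_ge1Dx addr_ge0 // divr_ge0.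
      rewrite ler_peMl ?prodr_ge0 //.
      by rewrite -[leLHS]expR0 ler_expR divr_ge0.
    have h2 : \sum_(i | i != o) `|theta| / `|x i| <= 1 / 2.
      by rewrite -mulr_sumr (le_trans (ler_wpM2l _ hsum)) //; lra.
    rewrite (le_trans (_ : _ <= expR (1/2))) ?ler_expR //.
    have := expR_sub1_bound (_ : `|1/2 : R| <= 1/2); rewrite ger0_norm ?divr_ge0 // => /(_ (lexx _)).
    by rewrite ler_norml => /andP[_]; lra.
  have den0 := lt_le_trans D0 den.
  rewrite /a normr_prod (eq_bigr (fun i => `|theta - x i| / `|x j - x i|)) => [|i _]; last first.
    by rewrite normrM normfV.
  rewrite prodf_div ler_pdivrMr // (le_trans num) //.
  rewrite [leLHS](_ : _ = 2 * `|theta| * `|x j|^-1 * (N`!%:R * N`!%:R)); last by ring.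
  by rewrite ler_wpM2l // !mulr_ge0 // invr_ge0.
have sj : \sum_(j | j != o) `|a j| <= 8 * (`|theta| * Num.sqrt N%:R).
  apply: (@le_trans _ _ (\sum_(j | j != o) 2 * `|theta| * `|x j|^-1)); first exact: ler_sum.
  rewrite -mulr_sumr (le_trans (ler_wpM2l _ hsum)) ?mulr_ge0 //; lra.
(* The central weight is not estimated directly: exactness on constants makes its deviation from 1
   the sum of the other weights, which doubles 8 to 16. *)
have a1 : \sum_j a j = 1.
  have := exact 1%:P ltac:(by rewrite size_polyC oner_eq0 addnS); rewrite hornerC => ->.
  by apply: eq_bigr => j _; rewrite hornerC mulr1.
rewrite (bigD1 o) //= addn0 eqxx.
have -> : a o - 1 = - \sum_(j | j != o) a j by rewrite -a1 (bigD1 o) //=; ring.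
rewrite normrN [X in _ + X](eq_bigr (fun j => `|a j|)) => [|j jo]; last by rewrite eo (negPf jo) subr0.
by rewrite (le_trans (lerD (ler_norm_sum _ _ _) (lexx _))) //; lra.
Qed.

(** * Charts along coordinate axes *)

Lemma enorm_ge0 (R : realType) m (x : 'rV[R]_m) : 0 <= enorm x.
Proof. exact: sqrtr_ge0. Qed.

Lemma sqr_enorm (R : realType) m (x : 'rV[R]_m) : enorm x ^+ 2 = \sum_(i < m) x 0 i ^+ 2.
Proof. by rewrite sqr_sqrtr // sumr_ge0 // => i _; rewrite sqr_ge0. Qed.

Lemma coord_le_enorm (R : realType) m (x : 'rV[R]_m) i : `|x 0 i| <= enorm x.
Proof.
rewrite -sqrtr_sqr ler_wsqrtr // (bigD1 i) //= lerDl sumr_ge0 // => j _.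
exact: sqr_ge0.
Qed.

Lemma enorm_le_sup (R : realType) m (x : 'rV[R]_m) a :
  (forall i, `|x 0 i| <= a) -> enorm x <= m%:R * a.
Proof.
case: m x => [|m] x xa; first by rewrite /enorm big_ord0 sqrtr0 mul0r.
have a0 : 0 <= a by apply: le_trans (xa ord0).
rewrite -[leRHS]ger0_norm ?mulr_ge0 // -sqrtr_sqr ler_wsqrtr //.
apply: (@le_trans _ _ (\sum_(i < m.+1) a ^+ 2)).
  by apply: ler_sum => i _; rewrite -real_normK ?num_real // lerXn2r ?nnegrE.
rewrite sumr_const card_ord -[leLHS]mulr_natl exprMn ler_wpM2r ?sqr_ge0 //.
by rewrite expr2 ler_peMl // ler1n.
Qed.

Lemma enormN (R : realType) m (x : 'rV[R]_m) : enorm (- x) = enorm x.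
Proof. by congr Num.sqrt; apply: eq_bigr => i _; rewrite mxE sqrrN. Qed.

Lemma enorm0 (R : realType) m : enorm (0 : 'rV[R]_m) = 0.
Proof. by rewrite /enorm big1 ?sqrtr0 // => i _; rewrite mxE expr0n. Qed.

Lemma enorm_continuous (R : realType) m : continuous (@enorm R m).
Proof.
have sc : continuous (fun y : 'rV[R]_m => \sum_(i < m) y 0 i ^+ 2 : R).
  apply: (@continuous_big _ _ +%R 0 xpredT) => [|i _ x]; first exact: add_continuous.
  apply: (@continuous_comp _ _ _ (fun y : 'rV[R]_m => y 0 i) (fun z : R => z ^+ 2)).
    exact: coord_continuous.
  exact: exprn_continuous.
move=> x; apply: (@continuous_comp _ _ _ _ Num.sqrt); first exact: sc.
exact: sqrt_continuous.
Qed.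

Lemma open_open_eball (R : realType) m (a : R) : open (@open_eball R m a).
Proof.
apply: (@open_comp _ _ (@enorm R m) [set y | y < a]); last exact: open_lt.
move=> x _; exact: enorm_continuous.
Qed.

Lemma is_derive_line (R : realType) k d (g : 'rV[R]_k -> 'rV[R]_d) u v (s : R) c :
  derivable g (u + s *: v) v ->
  is_derive s (1 : R) (fun t : R => g (u + t *: v) 0 c) (('D_v g (u + s *: v)) 0 c).
Proof.
move=> dg.
have e : (fun h : R => h^-1 *: (((fun t : R => g (u + t *: v)) \o shift s) (h *: (1 : R)) - g (u + s *: v))) =
    (fun h : R => h^-1 *: ((g \o shift (u + s *: v)) (h *: v) - g (u + s *: v))).
  apply/funext => h /=; congr (_ *: (g _ - _)).
  by rewrite [h *: 1]mulr1 scalerDl addrCA.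
have dl : derivable (fun t : R => g (u + t *: v)) s 1 by rewrite /derivable e.
have De : 'D_1 (fun t : R => g (u + t *: v)) s = 'D_v g (u + s *: v).
  by rewrite /derive e.
have := derive_mx dl; rewrite De => ->; rewrite mxE.
by apply: DeriveDef => //; have /derivable_mxP := dl; apply.
Qed.

(** On an open set the local extension F agrees with f near each point, hence so do all iterated
    partial derivatives. *)
Lemma smooth_on_derivable (R : realType) m l (A : set 'rV[R]_m) (f : 'rV[R]_m -> 'rV[R]_l) :
  open A -> smooth_on A f -> forall s x i, A x ->
  derivable (iter_partial s f) x (delta_mx 0 i).
Proof.
move=> oA sf s x i Ax; have [W [F [oW Wx sF FE]]] := sf x Ax.
have loc y : A y -> W y -> \forall z \near y, A z /\ W z.
  by move=> Ay Wy; near=> z; split; near: z; exact: open_nbhs_nbhs.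
have E s' : forall y, A y -> W y -> iter_partial s' F y = iter_partial s' f y.
  elim: s' => [|j s' IH] y Ay Wy /=; first exact: FE.
  apply: near_eq_derive; near=> z.
  have [] : A z /\ W z by near: z; exact: loc.
  exact: IH.
have [_ dF] := sF s x Wx.
apply: near_eq_derivable (dF i); near=> z.
have [] : A z /\ W z by near: z; exact: loc.
exact: E.
Unshelve. all: by end_near. Qed.

Lemma mderive_axis (R : realType) k l (i : 'I_k) m (f : 'rV[R]_k -> 'rV[R]_l) :
  mderive [ffun j => if j == i then m else 0%N] f = iter_partial (nseq m i) f.
Proof.
congr iter_partial.
have H (t : seq 'I_k) : uniq t ->
    flatten [seq nseq ([ffun j => if j == i then m else 0%N] j) j | j <- t] =
    if i \in t then nseq m i else [::].
  elim: t => //= j t IH /andP[jt /IH ->]; rewrite ffunE in_cons.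
  case: eqVneq jt => [-> it|_ _] //=.
  by rewrite (negPf it) cats0.
by rewrite H ?enum_uniq // mem_enum.
Qed.

Lemma mindex_size_axis k (i : 'I_k) m :
  mindex_size [ffun j => if j == i then m else 0%N] = m.
Proof.
rewrite /mindex_size (bigD1 i) //= ffunE eqxx big1 ?addn0 // => j ji.
by rewrite ffunE (negPf ji).
Qed.

(* Only pure derivatives along one axis are retained, which avoids the symmetry of
   mixed partial derivatives. *)
Definition chart_bound (R : realType) k d (r Q : R) (f : 'rV[R]_k -> 'rV[R]_d) : Prop :=
  forall m i u, (0 < m)%N -> open_eball r u -> enorm (iter_partial (nseq m i) f u) <= Q ^+ m.

Lemma wiener_axis (R : realType) k d (r Q A rho : R) (f : 'rV[R]_k -> 'rV[R]_d) u i c :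
  smooth_on (open_eball r) f -> chart_bound r Q f ->
  0 < rho -> 0 < Q -> Q * rho <= 1/2 ->
  (forall s, `|s| <= rho -> open_eball r (u + s *: delta_mx 0 i)) ->
  `|f u 0 c| <= A ->
  wiener rho (A + 1) (fun s => f (u + s *: delta_mx 0 i) 0 c).
Proof.
move=> sf bf r0 Q0 Qr inb fA.
apply: (@wiener_taylor _ rho A Q
  (fun m s => iter_partial (nseq m i) f (u + s *: delta_mx 0 i) 0 c)) => //.
- move=> m s sr; apply: is_derive_line.
  exact: smooth_on_derivable (@open_open_eball _ _ _) sf _ _ _ (inb s sr).
- move=> m s m0 sr; rewrite (le_trans (coord_le_enorm _ _)) //.
  exact: bf m0 (inb s sr).
- by rewrite scale0r addr0.
Qed.

(** What matters is that the constant depends on d, eta and A only, not on the chart, the base point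
    or x. Each coordinate of x - f contributes A for x and A + 1 for the chart. *)
Lemma wiener_gaussian (R : realType) k d (r Q A rho eta : R) (f : 'rV[R]_k -> 'rV[R]_d) u i (x : 'rV[R]_d) :
  smooth_on (open_eball r) f -> chart_bound r Q f ->
  0 < rho -> 0 < Q -> Q * rho <= 1/2 -> 0 <= A -> 0 <= eta ->
  (forall s, `|s| <= rho -> open_eball r (u + s *: delta_mx 0 i)) ->
  (forall c, `|f u 0 c| <= A) -> (forall c, `|x 0 c| <= A) ->
  wiener rho (expR (d%:R * (eta * ((A + (A + 1)) * (A + (A + 1))))))
    (fun s => gaussian eta x (f (u + s *: delta_mx 0 i))).
Proof.
move=> sf bf r0 Q0 Qr A0 eta0 inb fA xA.
have AA : 0 <= A + (A + 1) by rewrite !addr_ge0.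
apply: wiener_exp; rewrite ?(ltW r0) ?mulr_ge0 //.
rewrite (_ : (fun s => _) = fun s => \sum_(c < d)
   (- eta) * ((x 0 c + - 1 * f (u + s *: delta_mx 0 i) 0 c) *
              (x 0 c + - 1 * f (u + s *: delta_mx 0 i) 0 c))); last first.
  apply/funext => s; rewrite sqr_enorm mulr_sumr; apply: eq_bigr => c _.
  by rewrite !mxE mulN1r expr2.
have w c : wiener rho (A + (A + 1)) (fun s => x 0 c + - 1 * f (u + s *: delta_mx 0 i) 0 c).
  apply: wienerD; first exact: ltW.
    exact: wiener_le (xA c) (wiener_cst _ _).
  apply: (@wiener_le _ _ (`|-1| * (A + 1))); first by rewrite normrN1 mul1r.
  apply: wienerM; rewrite ?(ltW r0) ?addr_ge0 //; first exact: wiener_cst.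
  exact: wiener_axis sf bf r0 Q0 Qr inb (fA c).
apply: wiener_sum => [|c]; first exact: ltW.
apply: (@wiener_le _ _ (`|- eta| * ((A + (A + 1)) * (A + (A + 1))))).
  by rewrite normrN ger0_norm.
apply: wienerM; rewrite ?(ltW r0) ?mulr_ge0 //; first exact: wiener_cst.
by apply: wienerM; rewrite ?(ltW r0).
Qed.

(** * Functions with densely distributed zeros *)

Lemma axis_coord (R : realType) k (u : 'rV[R]_k) (s : R) i c :
  (u + s *: delta_mx 0 i) 0 c = u 0 c + s * (c == i)%:R.
Proof. by rewrite !mxE eqxx. Qed.

(** The path changes one coordinate at a time, so every corner has each coordinate equal to that of
    u or of v; coordinatewise bounds are therefore inherited by all corners. *)
Lemma axis_path_bound (R : realType) k (G : 'rV[R]_k -> R) (u v : 'rV[R]_k) (b : 'I_k -> R) :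
  (forall l (w : 'rV[R]_k), (forall c, w 0 c = u 0 c \/ w 0 c = v 0 c) -> w 0 l = u 0 l ->
     `|G (w + (v 0 l - u 0 l) *: delta_mx 0 l) - G w| <= b l) ->
  `|G v - G u| <= \sum_l b l.
Proof.
move=> step.
pose w (l : nat) : 'rV[R]_k := \row_c (if (c < l)%N then v 0 c else u 0 c).
have w0 : w 0%N = u by apply/rowP => c; rewrite mxE ltn0.
have wk : w k = v by apply/rowP => c; rewrite mxE ltn_ord.
have wS (l : 'I_k) : w l.+1 = w l + (v 0 l - u 0 l) *: delta_mx 0 l.
  apply/rowP => c; rewrite axis_coord !mxE ltnS leq_eqVlt.
  have [->|cl] := eqVneq c l; first by rewrite eqxx /= ltnn mulr1 addrC subrK.
  by rewrite val_eqE (negPf cl) /= mulr0 addr0.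
have -> : G v - G u = \sum_(l < k) (G (w l.+1) - G (w l)).
  rewrite -(big_mkord xpredT (fun l => G (w l.+1) - G (w l))).
  by rewrite telescope_sumr // w0 wk.
rewrite (le_trans (ler_norm_sum _ _ _)) // ler_sum // => l _; rewrite wS.
apply: step => [c|]; last by rewrite mxE ltnn.
by rewrite mxE; case: ifP; [right|left].
Qed.

(** The squared native norm of the functional g -> \sum_i a_i g(p_i), written without a Hilbert
    space. *)
Definition gram (R : realType) (E : Type) (ker : E -> E -> R) m
    (a : 'I_m -> R) (p : 'I_m -> E) : R :=
  \sum_i a i * \sum_j a j * ker (p i) (p j).

(* When ker is the reproducing kernel of H, this says that g lies in H and has
   norm at most S. *)
Definition native_bounded (R : realType) (E : Type) (ker : E -> E -> R)
    (g : E -> R) (S : R) : Prop :=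
  forall m (a : 'I_m -> R) (p : 'I_m -> E),
    `|\sum_i a i * g (p i)| <= S * Num.sqrt (gram ker a p).

Lemma native_bounded_point (R : realType) (E : Type) (ker : E -> E -> R) g S x :
  native_bounded ker g S -> ker x x = 1 -> `|g x| <= S.
Proof.
move=> gS kx; have := gS 1%N (fun=> 1) (fun=> x).
by rewrite /gram !big_ord1 !mul1r kx sqrtr1 mulr1.
Qed.

(** The functional with weight 1 at theta tau and - a_j at the nodes kills degree at most 2N. Its
    Gram form is estimated by using this in one kernel variable only, which gives (1/16)^(2N), and
    the square root leaves (1/16)^N. What remains of the difference is a sum of node values weighted
    by the deviations of the a_j. *)
Lemma curve_step (R : realType) (E : Type) (ker : E -> E -> R) (g : E -> R)
    (S M rho tau theta B : R) (N : nat) (gam : R -> E) :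
  0 <= S -> 0 <= M -> 0 < rho -> 0 < tau -> (0 < N)%N -> N%:R * tau <= rho / 16 ->
  (forall s', `|s'| <= rho -> wiener rho M (fun s => ker (gam s') (gam s))) ->
  native_bounded ker g S ->
  `|theta| * Num.sqrt N%:R <= 1 / 8 ->
  (forall j : 'I_(N + N.+1), `|g (gam ((j%:R - N%:R) * tau))| <= B) ->
  `|g (gam (theta * tau)) - g (gam 0)| <=
    16 * (`|theta| * Num.sqrt N%:R) * B + S * (4 * Num.sqrt M * (1 / 16) ^+ N).
Proof.
move=> S0 M0 r0 t0 N0 Nt W gS th gB.
have [a [exact asum]] := extrapolation_weights th.
set n := (N + N.+1)%N in a exact asum gB *.
pose b (i : 'I_n.+1) : R := if unlift ord0 i is Some j then - a j else 1.
pose s (i : 'I_n.+1) : R :=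
  if unlift ord0 i is Some j then (j%:R - N%:R) * tau else theta * tau.
have b0 : b ord0 = 1 by rewrite /b unlift_none.
have bl j : b (lift ord0 j) = - a j by rewrite /b liftK.
have s0 : s ord0 = theta * tau by rewrite /s unlift_none.
have sl j : s (lift ord0 j) = (j%:R - N%:R) * tau by rewrite /s liftK.
have N1 : 1 <= N%:R :> R by rewrite ler1n.
have th1 : `|theta| <= 1.
  apply: (@le_trans _ _ (`|theta| * Num.sqrt N%:R)); last by lra.
  by rewrite ler_peMr // -[leLHS]sqrtr1 ler_sqrt.
have ss i : `|s i| <= N%:R * tau.
  case: (unliftP ord0 i) => [j ->|->]; last first.
    by rewrite s0 normrM (gtr0_norm t0) ler_wpM2r ?(ltW t0) // (le_trans th1).
  rewrite sl normrM (gtr0_norm t0) ler_wpM2r ?(ltW t0) // ler_norml.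
  have : j%:R <= N%:R + N%:R :> R by rewrite -natrD ler_nat -ltnS -addnS ltn_ord.
  by have : 0 <= j%:R :> R by []; lra.
have kill (q : {poly R}) : (size q <= n)%N -> \sum_i b i * q.[s i] = 0.
  move=> sq; rewrite big_ord_recl b0 s0 mul1r.
  have := exact (q \Po (tau *: 'X)) _; rewrite horner_comp hornerZ hornerX.
  rewrite mulrC => ->; last first.
    rewrite (leq_trans (size_comp_poly_leq _ _)) // size_scale ?lt0r_neq0 // size_polyX muln1.
    by case: (size q) sq => // _; rewrite /n addnS.
  rewrite -big_split big1 // => j _ /=.
  by rewrite bl sl horner_comp hornerZ hornerX [tau * _]mulrC mulNr subrr.
pose o : 'I_n := rshift N ord0.
have oE (j : 'I_n) : (j == N :> nat) = (j == o) by rewrite -val_eqE /= addn0.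
(* 4 = 1 + 1 + 16 / 8: the extrapolated point, the central node, and the total deviation of the
   weights. *)
have bsum : \sum_i `|b i| <= 4.
  rewrite big_ord_recl b0 normr1.
  apply: (@le_trans _ _ (1 + (\sum_j `|a j - (j == N :> nat)%:R| + 1))); last by lra.
  rewrite lerD2l // [X in _ <= _ + X](_ : 1 = \sum_(j < n) (j == N :> nat)%:R); last first.
    by rewrite (bigD1 o) //= addn0 eqxx big1 ?addr0 // => j jo; rewrite oE (negPf jo).
  rewrite -big_split; apply: ler_sum => j _ /=.
  rewrite bl normrN -[a j in leLHS](subrK (j == N :> nat)%:R).
  by rewrite (le_trans (ler_normD _ _)) // normr_nat.
have bsum0 : 0 <= \sum_i `|b i| by exact: sumr_ge0.
have r16 : N%:R * tau / rho <= 1/16 by rewrite ler_pdivrMr // mulrC; lra.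
have rr0 : 0 <= N%:R * tau / rho by rewrite divr_ge0 ?mulr_ge0 ?(ltW t0) ?(ltW r0).
have rE : (N%:R * tau / rho) ^+ n <= ((1 / 16) ^+ N) ^+ 2.
  rewrite -exprM muln2 -addnn /n addnS exprS.
  apply: (@le_trans _ _ (1 * (N%:R * tau / rho) ^+ (N + N))).
    by rewrite ler_wpM2r ?exprn_ge0 //; lra.
  by rewrite mul1r lerXn2r ?nnegrE // divr_ge0.
have z0 : 0 <= (1 / 16 : R) ^+ N by rewrite exprn_ge0 // divr_ge0.
move: z0 rE; set z := (1 / 16 : R) ^+ N => z0 rE.
have Nr : N%:R * tau <= rho by lra.
have G : gram ker b (gam \o s) <= (4 * Num.sqrt M * z) ^+ 2.
  have inner i : `|\sum_j b j * ker (gam (s i)) (gam (s j))| <= 4 * (M * (z) ^+ 2).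
    have sr : `|s i| <= rho by rewrite (le_trans (ss _)).
    apply: (le_trans (wiener_functional r0 M0 Nr (W _ sr) ss kill)).
    apply: ler_pM; [exact: bsum0 | by rewrite mulr_ge0 // exprn_ge0 | exact: bsum | exact: ler_wpM2l].
  rewrite (le_trans (ler_norm _)) // /gram (le_trans (ler_norm_sum _ _ _)) //.
  apply: (@le_trans _ _ ((\sum_i `|b i|) * (4 * (M * (z) ^+ 2)))).
    by rewrite mulr_suml; apply: ler_sum => i _; rewrite normrM ler_wpM2l //; apply: inner.
  rewrite !exprMn sqr_sqrtr //.
  apply: (@le_trans _ _ (4 * (4 * (M * (z) ^+ 2)))).
    by apply: ler_wpM2r => //; rewrite !mulr_ge0 // exprn_ge0.
  by rewrite le_eqVlt; apply/orP; left; apply/eqP; ring.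
have /= Lg := gS _ b (gam \o s).
have Q0 : 0 <= 4 * Num.sqrt M * z.
  by rewrite !mulr_ge0 ?sqrtr_ge0.
have {}Lg : `|\sum_i b i * g (gam (s i))| <= S * (4 * Num.sqrt M * z).
  rewrite (le_trans Lg) // ler_wpM2l // -[leRHS](ger0_norm Q0) -sqrtr_sqr.
  by rewrite ler_wsqrtr.
have -> : g (gam (theta * tau)) - g (gam 0) = \sum_i b i * g (gam (s i)) +
    \sum_j (a j - (j == N :> nat)%:R) * g (gam ((j%:R - N%:R) * tau)).
  rewrite big_ord_recl b0 s0 mul1r -addrA -big_split (bigD1 o) //= bl sl /= addn0 eqxx.
  rewrite subrr mul0r big1 => [|j jo]; last by rewrite bl sl oE (negPf jo) subr0 mulNr addNr.
  by rewrite mulr1n; ring.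
rewrite [leRHS]addrC (le_trans (ler_normD _ _)) // lerD //.
rewrite (le_trans (ler_norm_sum _ _ _)) //.
have B0 : 0 <= B by apply: le_trans (gB o).
apply: (@le_trans _ _ ((\sum_j `|a j - (j == N :> nat)%:R|) * B)); last by rewrite ler_wpM2r.
by rewrite mulr_suml; apply: ler_sum => j _; rewrite normrM ler_wpM2l.
Qed.

Definition in_box (R : realType) k (u0 : 'rV[R]_k) (a : R) (u : 'rV[R]_k) : Prop :=
  forall c, `|u 0 c - u0 0 c| <= a.

(* N steps, each replacing the box by one smaller by rho / (16 N) and dividing the
   bound on g by 4. *)
Lemma dense_zeros_small (R : realType) (E : Type) (ker : E -> E -> R) (g : E -> R)
    (k : nat) (S M rho delta : R) (N : nat) (phi : 'rV[R]_k -> E) (u0 : 'rV[R]_k) :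
  (0 < k)%N -> 0 <= S -> 0 <= M -> 0 < rho -> 0 <= delta -> (0 < N)%N ->
  (forall x, ker x x = 1) ->
  (forall u i s', in_box u0 rho u -> `|s'| <= rho ->
     wiener rho M (fun s => ker (phi (u + s' *: delta_mx 0 i)) (phi (u + s *: delta_mx 0 i)))) ->
  native_bounded ker g S ->
  (forall u, in_box u0 rho u -> exists2 v, in_box u delta v & g (phi v) = 0) ->
  k%:R * 64 * (16 * N%:R * N.+1%:R * delta / rho * Num.sqrt N%:R) <= 1 ->
  `|g (phi u0)| <= S * (1 + 8 * k%:R * Num.sqrt M) * (1 / 4) ^+ N.
Proof.
move=> k0 S0 M0 r0 d0 N0 k1 W gS dense small.
have Np : 0 < N%:R :> R by rewrite ltr0n.
have N1p : 0 < N.+1%:R :> R by rewrite ltr0n.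
have k1R : 1 <= k%:R :> R by rewrite ler1n.
(* One step loses the width t = (N + 1) tau: N tau for the nodes on either side and one tau for the
   move of length at most delta <= tau. The N steps together use only rho / 16. *)
pose tau := rho / (16 * N%:R * N.+1%:R).
have t0 : 0 < tau by rewrite divr_gt0 // !mulr_gt0.
pose t := rho / (16 * N%:R).
have tE : t = N.+1%:R * tau by rewrite /t /tau; field; rewrite !lt0r_neq0.
pose th := delta / tau.
have th0 : 0 <= th by rewrite divr_ge0 // ltW.
have thE : 16 * N%:R * N.+1%:R * delta / rho = th.
  by rewrite /th /tau; field; rewrite !lt0r_neq0.
rewrite thE in small.
have sq1 : 1 <= Num.sqrt N%:R :> R by rewrite -[leLHS]sqrtr1 ler_sqrt // ler1n.
have ths0 : 0 <= th * Num.sqrt N%:R by rewrite mulr_ge0 // sqrtr_ge0.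
have small8 : th * Num.sqrt N%:R <= 1 / 64 by nra.
have th1 : th <= 1 / 64 by nra.
have dtau : delta <= tau by move: th1; rewrite ler_pdivrMr //; lra.
pose Rm := 4 * Num.sqrt M * (1 / 16 : R) ^+ N.
have Rm0 : 0 <= Rm by rewrite !mulr_ge0 ?sqrtr_ge0 // exprn_ge0 // divr_ge0.
have Ntau : N%:R * tau <= rho / 16.
  have -> : N%:R * tau = rho / 16 / N.+1%:R by rewrite /tau; field; rewrite !lt0r_neq0.
  by rewrite ler_pdivrMr // ler_peMr ?divr_ge0 ?(ltW r0) // ler1n.
(* The hypothesis with 64 = 4 * 16 makes one step give B / 4 + k S Rm. The accumulated error stays
   below 2 k Rm because 2 / 4 + 1 <= 2. *)
have main m : (m <= N)%N -> forall u, in_box u0 (rho - m%:R * t) u ->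
    `|g (phi u)| <= S * ((1 / 4) ^+ m + 2 * k%:R * Rm).
  elim: m => [|m IH] mN u bu.
    rewrite expr0 (le_trans (native_bounded_point gS (k1 _))) // ler_peMr // lerDl.
    by rewrite !mulr_ge0.
  have {}IH := IH (ltnW mN).
  set B := S * _ in IH.
  have B0 : 0 <= B by rewrite mulr_ge0 // addr_ge0 ?mulr_ge0 // exprn_ge0 // divr_ge0.
  have tp : 0 < t by rewrite divr_gt0 // mulr_gt0.
  have mt0 : 0 <= m%:R * t by rewrite mulr_ge0 // ltW.
  have m1t : m.+1%:R * t = m%:R * t + t by rewrite -natr1 mulrDl mul1r.
  have Nt0 : 0 <= N%:R * tau by rewrite mulr_ge0 // ltW.
  have tD : t = N%:R * tau + tau by rewrite tE -natr1 mulrDl mul1r.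
  have [|v bv gv] := dense u.
    by move=> c; rewrite (le_trans (bu c)) //; lra.
  have : `|g (phi v) - g (phi u)| <= \sum_(l < k) (16 * (th * Num.sqrt N%:R) * B + S * Rm).
    apply: (@axis_path_bound _ _ (g \o phi)) => l w wE wl /=.
    have wu c : `|w 0 c - u 0 c| <= delta.
      by have [->|->] := wE c; [rewrite subrr normr0 | exact: bv].
    have W' : forall s', `|s'| <= rho -> wiener rho M
        (fun s => ker (phi (w + s' *: delta_mx 0 l)) (phi (w + s *: delta_mx 0 l))).
      move=> s' sr; apply: W => // c; rewrite -[w 0 c](subrK (u 0 c)) -addrA.
      by rewrite (le_trans (ler_normD _ _)) // (le_trans (lerD (wu c) (bu _))) //; lra.
    pose th' := (v 0 l - u 0 l) / tau.
    have th'le : `|th'| <= th.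
      by rewrite normrM normfV (gtr0_norm t0) ler_wpM2r ?invr_ge0 ?(ltW t0) //; apply: bv.
    have th's : `|th'| * Num.sqrt N%:R <= th * Num.sqrt N%:R by rewrite ler_wpM2r // sqrtr_ge0.
    have := @curve_step _ _ ker g S M rho tau th' B N (fun s => phi (w + s *: delta_mx 0 l))
      S0 M0 r0 t0 N0 Ntau W' gS.
    rewrite scale0r addr0 divfK ?lt0r_neq0 // => h.
    rewrite (le_trans (h _ _)) //; first by lra.
      move=> j; apply: IH => c; rewrite axis_coord.
      have -> : w 0 c + (j%:R - N%:R) * tau * (c == l)%:R - u0 0 c =
         (w 0 c - u 0 c) + ((j%:R - N%:R) * tau * (c == l)%:R + (u 0 c - u0 0 c)) by ring.
      rewrite (le_trans (ler_normD _ _)) //.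
      rewrite (le_trans (lerD (wu c) (ler_normD _ _))) //.
      have jN : `|(j%:R - N%:R) * tau * (c == l)%:R| <= N%:R * tau.
        apply: (@le_trans _ _ (`|(j%:R - N%:R) * tau| * 1)).
          by rewrite normrM ler_wpM2l // normr_nat lern1 leq_b1.
        rewrite mulr1 normrM (gtr0_norm t0) ler_wpM2r ?(ltW t0) // ler_norml.
        have : j%:R <= N%:R + N%:R :> R by rewrite -natrD ler_nat -ltnS -addnS ltn_ord.
        by have : 0 <= j%:R :> R by []; lra.
      by have := bu c; lra.
    by rewrite lerD // ler_wpM2r // ler_wpM2l.
  rewrite sumr_const card_ord -[X in _ <= X -> _]mulr_natl.
  rewrite gv sub0r normrN => h; rewrite (le_trans h) //.
  have h1 : k%:R * (16 * (th * Num.sqrt N%:R)) * B <= 1/4 * B.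
    by rewrite ler_wpM2r //; lra.
  have SR : 0 <= S * (k%:R * Rm) by rewrite !mulr_ge0.
  have -> : k%:R * (16 * (th * Num.sqrt N%:R) * B + S * Rm) =
     k%:R * (16 * (th * Num.sqrt N%:R)) * B + S * (k%:R * Rm) by ring.
  rewrite (le_trans (lerD h1 (lexx _))) // /B exprS.
  have -> : S * (1 / 4 * (1 / 4) ^+ m + 2 * k%:R * Rm) =
     1/4 * (S * ((1 / 4) ^+ m + 2 * k%:R * Rm)) + 3/2 * (S * (k%:R * Rm)) by field.
  lra.
have bu0 : in_box u0 (rho - N%:R * t) u0.
  move=> c; rewrite subrr normr0 /t.
  have -> : rho - N%:R * (rho / (16 * N%:R)) = rho * (15 / 16) by field; rewrite lt0r_neq0.
  by rewrite mulr_ge0 ?(ltW r0) // divr_ge0.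
rewrite (le_trans (main N (leqnn N) _ bu0)) // -[leRHS]mulrA ler_wpM2l // [leRHS]mulrDl [X in _ <= X + _]mul1r lerD2l.
rewrite /Rm.
have -> : 2 * k%:R * (4 * Num.sqrt M * (1 / 16) ^+ N) = 8 * k%:R * Num.sqrt M * (1 / 16) ^+ N by ring.
rewrite ler_wpM2l ?mulr_ge0 ?sqrtr_ge0 // lerXn2r ?nnegrE ?divr_ge0 //.
lra.
Qed.

(** * Charts of uniform size on a compact manifold *)

Lemma near_box (R : realType) m (y : 'rV[R]_m) (P : 'rV[R]_m -> Prop) :
  (\forall x \near y, P x) -> exists2 a : R, 0 < a & forall x, in_box y a x -> P x.
Proof.
move=> /nbhs_ballP[a /= a0 aP]; exists (a / 2); first by rewrite divr_gt0.
move=> x xy; apply: aP; rewrite -ball_normE /ball_ /= /Num.Def.normr /= mx_normrE.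
apply: (@le_lt_trans _ _ (a / 2)); last by rewrite ltr_pdivrMr // ltr_pMr // ltr1n.
apply: bigmax_le => [|[i j] _]; first by rewrite divr_ge0 // ltW.
by rewrite !mxE ord1 distrC.
Qed.

Lemma box_near (R : realType) m (y : 'rV[R]_m) (a : R) : 0 < a ->
  \forall x \near y, in_box y a x.
Proof.
move=> a0; apply/nbhs_ballP; exists a => // x.
rewrite -ball_normE /ball_ /= /Num.Def.normr /= mx_normrE => xy c.
rewrite distrC; apply: ltW; apply: le_lt_trans xy.
have -> : y 0 c - x 0 c = (y - x) 0 c by rewrite !mxE.
exact: (le_bigmax _ (fun ij : 'I_1 * 'I_m => `|(y - x) ij.1 ij.2|) (0, c)).
Qed.

Lemma in_box_trans (R : realType) m (x y z : 'rV[R]_m) (a b : R) :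
  in_box x a y -> in_box y b z -> in_box x (a + b) z.
Proof.
move=> xy yz c; have -> : z 0 c - x 0 c = (y 0 c - x 0 c) + (z 0 c - y 0 c) by ring.
by rewrite (le_trans (ler_normD _ _)) // lerD.
Qed.

(** Continuity bounds the first partials near y, and a box contains the axis-parallel path between
    any two of its points, so the mean value bound applies on each leg. *)
Lemma smooth_locally_lipschitz (R : realType) d k (W : set 'rV[R]_d)
    (F : 'rV[R]_d -> 'rV[R]_k) y :
  open W -> W y -> smooth_on_open W F ->
  exists e C : R, [/\ 0 < e, 0 <= C & forall x x', in_box y e x -> in_box y e x' ->
    forall c, `|F x 0 c - F x' 0 c| <= C * enorm (x - x')].
Proof.
move=> oW Wy sF.
have bnd : \forall x \near y, W x /\
    forall l c, `|partial l F x 0 c| <= `|partial l F y 0 c| + 1.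
  near=> x; split; first by near: x; exact: open_nbhs_nbhs.
  near: x; apply: filter_forall => l; apply: filter_forall => c.
  have [/= cl _] := sF [:: l] y Wy.
  have cc : {for y, continuous (fun x => partial l F x 0 c)}.
    apply: (@continuous_comp _ _ _ (partial l F) (fun z : 'rV[R]_k => z 0 c)) => //.
    exact: coord_continuous.
  move/cvgrPdist_le : cc => /(_ 1 ltr01); apply: filterS => x; rewrite distrC => h.
  rewrite -[partial l F x 0 c](subrK (partial l F y 0 c)) (le_trans (ler_normD _ _)) //.
  by rewrite addrC lerD2l.
have [e e0 eP] := near_box bnd.
pose C c := \sum_l (`|partial l F y 0 c| + 1).
have C0 c : 0 <= C c by apply: sumr_ge0 => l _; rewrite addr_ge0.
exists e, (\sum_c C c); split => //; first by apply: sumr_ge0.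
move=> x x' bx bx' c.
apply: (@le_trans _ _ (C c * enorm (x - x'))); last first.
  by rewrite ler_wpM2r ?enorm_ge0 // (bigD1 c) //= lerDl sumr_ge0.
rewrite /C mulr_suml; apply: (@axis_path_bound _ _ (fun z => F z 0 c) x' x) => l w wE wl.
apply: (@le_trans _ _ ((`|partial l F y 0 c| + 1) * `|x 0 l - x' 0 l|)); last first.
  rewrite ler_wpM2l ?addr_ge0 //; have := coord_le_enorm (x - x') l.
  by rewrite !mxE.
set T := x 0 l - x' 0 l.
have bw t : 0 <= t <= 1 -> in_box y e (w + (t * T) *: delta_mx 0 l).
  move=> /andP[t0 t1] j; rewrite axis_coord.
  have [->|jl] := eqVneq j l; last first.
    by rewrite mulr0 addr0; case: (wE j) => ->; [exact: bx' | exact: bx].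
  rewrite mulr1 wl.
  have -> : x' 0 l + t * T - y 0 l = (1 - t) * (x' 0 l - y 0 l) + t * (x 0 l - y 0 l).
    by rewrite /T; ring.
  rewrite (le_trans (ler_normD _ _)) // !normrM (ger0_norm t0) ger0_norm ?subr_ge0 //.
  have -> : e = (1 - t) * e + t * e by ring.
  by rewrite lerD // ler_wpM2l ?subr_ge0.
have := @mean_value_bound _ (fun t => F (w + t *: delta_mx 0 l) 0 c)
  (fun t => partial l F (w + t *: delta_mx 0 l) 0 c) T (`|partial l F y 0 c| + 1).
rewrite scale0r addr0; apply.
  move=> t t01; apply: is_derive_line; have [Wt _] := eP _ (bw t t01).
  by have [_ /(_ l)] := sF [::] _ Wt.
by move=> t t01; have [_] := eP _ (bw t t01); apply.
Unshelve. all: by end_near. Qed.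

Lemma smooth_on_continuous (R : realType) m l (A : set 'rV[R]_m) (f : 'rV[R]_m -> 'rV[R]_l) x :
  open A -> smooth_on A f -> A x -> {for x, continuous f}.
Proof.
move=> oA sf Ax; have [W [F [oW Wx sF FE]]] := sf x Ax.
have [/= cF _] := sF [::] x Wx.
have loc : \forall z \near x, F z = f z.
  near=> z; apply: FE; near: z; exact: open_nbhs_nbhs.
have E := FE x Ax Wx; rewrite /prop_for /continuous_at -E; apply: cvg_trans cF.
exact: (near_eq_cvg loc).
Unshelve. all: by end_near. Qed.

(* Near y the chart Psi j contains a box of radius 2 rho on which its inverse
   does not contract distances to points of Omega by more than a factor L. *)
Definition good_chart (R : realType) (d k T : nat) (Omega : set 'rV[R]_d) (r : 'I_T -> R)
    (Psi_inv : 'I_T -> 'rV[R]_k -> 'rV[R]_d) (rho L : R) (y : 'rV[R]_d) : Prop :=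
  exists (j : 'I_T) (u0 : 'rV[R]_k), [/\ Psi_inv j u0 = y,
    forall u, in_box u0 (2 * rho) u -> open_eball (r j) u &
    forall u x, in_box u0 (2 * rho) u -> Omega x -> enorm (x - Psi_inv j u) <= rho ->
      exists2 v, Psi_inv j v = x & in_box u (L * enorm (x - Psi_inv j u)) v].

(** Points of Omega close to [Psi_inv j u] lie in U j because U j is relatively open, so v =
    [Psi j x] is available. L is a Lipschitz constant of the ambient extension F of Psi j around
    y. *)
Lemma good_chart_near (R : realType) (d k : nat) (Omega : set 'rV[R]_d)
    (T : nat) (U : 'I_T -> set 'rV[R]_d) (r : 'I_T -> R)
    (Psi : 'I_T -> 'rV[R]_d -> 'rV[R]_k) (Psi_inv : 'I_T -> 'rV[R]_k -> 'rV[R]_d) y :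
  ball_atlas Omega U r Psi Psi_inv -> Omega y ->
  exists a L : R, [/\ 0 < a, 0 <= L & \forall y' \near y, Omega y' ->
    forall rho, 0 < rho <= a -> good_chart Omega r Psi_inv rho L y'].
Proof.
move=> [Uo cov rpos dif] Oy.
have [j _ Ujy] := cov y Oy.
have [Oj [oOj UE]] := Uo j.
have [sPsi sInv PsiU InvB] := dif j.
have [W [F [oW Wy sF FE]]] := sPsi y Ujy.
have [e0 [C [e0p C0 lipF]]] := smooth_locally_lipschitz oW Wy sF.
have OW : \forall x \near y, Oj x /\ W x.
  near=> x; split; near: x; apply: open_nbhs_nbhs; split => //.
  by move: Ujy; rewrite UE => -[].
have [e1 e1p OWbox] := near_box OW.
pose e := Num.min e0 e1.
have ep : 0 < e by rewrite lt_min e0p.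
have bE x : in_box y e x -> in_box y e0 x /\ in_box y e1 x.
  by move=> b; split=> c; rewrite (le_trans (b c)) // ge_min lexx ?orbT.
pose us := Psi j y.
have [Bus Pus] := PsiU y Ujy.
have near_us : \forall u \near us, open_eball (r j) u /\ in_box y (e / 2) (Psi_inv j u).
  near=> u; split.
    by near: u; apply: open_nbhs_nbhs; split => //; exact: open_open_eball.
  near: u; have := smooth_on_continuous (@open_open_eball _ _ _) sInv Bus; apply.
  by rewrite Pus; apply: box_near; rewrite divr_gt0.
have [a ap aP] := near_box near_us.
have Fy : F y = us by rewrite FE.
have cF : {for y, continuous F} by have [] := sF [::] y Wy.
have near_y : \forall y' \near y, in_box y e y' /\ in_box us (a / 2) (F y').
  near=> y'; split; first by near: y'; exact: box_near.
  near: y'; apply: cF; rewrite Fy; apply: box_near; rewrite divr_gt0 //.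
(* With rho <= a / 4, the box of radius 2 rho about [F y'], itself within a / 2 of [us], stays in
   the a-box; with rho <= e / 2, a point within rho of the (e / 2)-box stays in the e-box. *)
exists (Num.min (a / 4) (e / 2)), C; split => //.
  by rewrite lt_min !divr_gt0.
near=> y'.
have [by' bF] : in_box y e y' /\ in_box us (a / 2) (F y') by near: y'.
move=> Oy' rho /andP[rho0]; rewrite le_min => /andP[rhoa rhoe].
have UE' x : Omega x -> in_box y e x -> U j x /\ F x = Psi j x.
  move=> Ox /bE[_ b1]; have [Ojx Wx] := OWbox x b1.
  have Ux : U j x by rewrite UE.
  by split=> //; exact: FE.
have [Uy' Fy'] := UE' y' Oy' by'.
have [By' Py'] := PsiU y' Uy'.
have inbox u : in_box (Psi j y') (2 * rho) u -> in_box us a u.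
  rewrite -Fy' => b c; have := in_box_trans bF b c.
  by move=> h; rewrite (le_trans h) //; lra.
exists j, (Psi j y'); split => //.
  by move=> u /inbox /aP[].
move=> u x /inbox bu Ox xr.
have [Bu bPu] := aP u bu.
have [Uu Pu] := InvB u Bu.
have bx : in_box y e x.
  have h : in_box (Psi_inv j u) (e / 2) x.
    by move=> c; have := coord_le_enorm (x - Psi_inv j u) c; rewrite !mxE; lra.
  by move=> c; have := in_box_trans bPu h c; rewrite -splitr.
have [Ux Fx] := UE' x Ox bx.
have [Bx Px] := PsiU x Ux.
exists (Psi j x) => // c.
have OPu : Omega (Psi_inv j u) by move: Uu; rewrite UE => -[].
have bPu' : in_box y e (Psi_inv j u) by move=> c'; have := bPu c'; lra.
have [_ FPu] := UE' _ OPu bPu'.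
rewrite -Fx -{1}Pu -FPu; apply: lipF; first exact: (bE _ bx).1.
exact: (bE _ bPu').1.
Unshelve. all: by end_near. Qed.

(** A single n carries both constants, as a = 1 / (n + 1) and L = n + 1. The property weakens as n
    grows, so compactness applies along the filter [\oo]. *)
Lemma good_chart_uniform (R : realType) (d k : nat) (Omega : set 'rV[R]_d)
    (T : nat) (U : 'I_T -> set 'rV[R]_d) (r : 'I_T -> R)
    (Psi : 'I_T -> 'rV[R]_d -> 'rV[R]_k) (Psi_inv : 'I_T -> 'rV[R]_k -> 'rV[R]_d) :
  ball_atlas Omega U r Psi Psi_inv -> compact Omega ->
  exists a L : R, [/\ 0 < a, 0 < L & forall y, Omega y ->
    forall rho, 0 < rho <= a -> good_chart Omega r Psi_inv rho L y].
Proof.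
move=> atl /compact_near_coveringP/near_covering_withinP cov.
have := cov nat \oo (fun n y => forall rho, 0 < rho <= n.+1%:R^-1 ->
  good_chart Omega r Psi_inv rho n.+1%:R y) _.
case=> [x Ox|n _ nP].
  have [a [L [a0 L0 nr]]] := good_chart_near atl Ox.
  have nbig : \forall n \near \oo, (n.+1%:R)^-1 <= a /\ L <= n.+1%:R.
    exists (Num.truncn (Num.max a^-1 L)) => //= n /= Nn.
    have : Num.max a^-1 L < n.+1%:R.
      by rewrite (lt_le_trans (truncnS_gt _)) // ler_nat.
    rewrite gt_max => /andP[h1 h2]; split; last exact: ltW.
    by rewrite -[leRHS]invrK lef_pV2 ?posrE ?invr_gt0 // ltW.
  near=> x' n => Ox' rho /andP[rho0 rhon].
  have [na nL] : (n.+1%:R)^-1 <= a /\ L <= n.+1%:R by near: n.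
  have : Omega x' -> forall rho, 0 < rho <= a -> good_chart Omega r Psi_inv rho L x'.
    by near: x'.
  move=> /(_ Ox' rho); rewrite rho0 (le_trans rhon na) => /(_ isT).
  case=> [j [u0 [E B H]]]; exists j, u0; split => // u z bu Oxx xr.
  have [v vx bv] := H u z bu Oxx xr; exists v => // c.
  by rewrite (le_trans (bv c)) // ler_wpM2r ?enorm_ge0.
exists n.+1%:R^-1, n.+1%:R; split; rewrite ?invr_gt0 ?ltr0n //.
by move=> y Oy; apply: nP => //=.
Unshelve. all: by end_near. Qed.

Lemma chart_bound_of_mderive (R : realType) (d k : nat) (r Q : R) (f : 'rV[R]_k -> 'rV[R]_d) :
  (forall alpha : {ffun 'I_k -> nat}, (exists i, alpha i <> 0%N) ->
     (ereal_sup [set (enorm (mderive alpha f u))%:E | u in open_eball r]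
        <= (Q ^+ mindex_size alpha)%:E)%E) ->
  chart_bound r Q f.
Proof.
move=> hb m i u m0 ru.
have := hb [ffun j => if j == i then m else 0%N] _.
rewrite mindex_size_axis => h.
rewrite -lee_fin; apply: le_trans (h _); last first.
  by exists i; rewrite ffunE eqxx => m0'; rewrite m0' in m0.
by apply: ereal_sup_ubound; exists u => //; rewrite mderive_axis.
Qed.

(** * Exponential decay in terms of the density of the zeros *)

Lemma expRN1_quarter (R : realType) : (1 / 4 : R) <= expR (-1).
Proof.
have h : expR (1 / 2 : R) <= 2.
  have := expR_sub1_bound (_ : `|1/2 : R| <= 1/2); rewrite ger0_norm ?divr_ge0 // => /(_ (lexx _)).
  by rewrite ler_norml => /andP[_]; lra.
rewrite expRN div1r lef_pV2 ?posrE ?expR_gt0 //.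
have -> : (1 : R) = 1 / 2 + 1 / 2 by field.
by rewrite expRD; have := expR_ge0 (1 / 2 : R); nra.
Qed.

Lemma powR_half5 (R : realType) (N : R) : 0 <= N -> N `^ (5 / 2) = N ^+ 2 * Num.sqrt N.
Proof.
move=> N0; have -> : (5 / 2 : R) = 2%:R + 2^-1 by field.
rewrite powRD ?powR_mulrn ?powR12_sqrt //.
by apply/implyP => /eqP h; lra.
Qed.

(** The smallness condition of [dense_zeros_small], with s = sqrt N, a = 64 and b = 16; the factor 2
    pays for N + 1 <= 2 N. *)
Lemma step_size_bound (R : realType) (k N L h rho s a b : R) :
  0 <= k -> 1 <= N -> 0 < L -> 0 < h -> 0 < rho -> 0 <= s -> 0 <= a -> 0 <= b ->
  N ^+ 2 * s * (2 * (k * a * b) * L * h) <= rho ->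
  k * a * (b * N * (N + 1) * (L * h) / rho * s) <= 1.
Proof.
move=> k0 N1 L0 h0 r0 s0 a0 b0 H.
have -> : k * a * (b * N * (N + 1) * (L * h) / rho * s) =
  (k * a * b * L * h * s * N) * (N + 1) / rho by ring.
rewrite ler_pdivrMr // mul1r (le_trans _ H) //.
have -> : N ^+ 2 * s * (2 * (k * a * b) * L * h) = (k * a * b * L * h * s * N) * (2 * N) by ring.
rewrite ler_wpM2l //; last by lra.
by rewrite !mulr_ge0 // ?ltW //; lra.
Qed.

Lemma zeros_decay (R : realType) (d k : nat) (rb : R) (Omega : set 'rV[R]_d)
    (T : nat) (U : 'I_T -> set 'rV[R]_d) (r : 'I_T -> R)
    (Psi : 'I_T -> 'rV[R]_d -> 'rV[R]_k) (Psi_inv : 'I_T -> 'rV[R]_k -> 'rV[R]_d)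
    (Q eta : R) :
  (0 < k)%N -> Omega `<=` closed_eball rb -> compact Omega ->
  ball_atlas Omega U r Psi Psi_inv -> 0 < Q ->
  (forall j, chart_bound (r j) Q (Psi_inv j)) -> 0 < eta ->
  exists c h0 : R, [/\ 0 < c, 0 < h0 & forall h, 0 < h <= h0 ->
    forall g S, 0 <= S -> native_bounded (@gaussian R d eta) g S ->
    (forall y, Omega y -> exists x, [/\ Omega x, g x = 0 & enorm (x - y) <= h]) ->
    forall y, Omega y -> `|g y| <= expR (- c * h `^ (- (2 / 5))) * S].
Proof.
move=> k0 Orb cO atl Q0 cb eta0.
have [a [L [a0 L0 good]]] := good_chart_uniform atl cO.
(* The first bound keeps boxes inside a chart, the second makes the Taylor series of the chart
   converge geometrically. *)
pose rho := Num.min a (1 / (2 * Q)).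
have r0 : 0 < rho by rewrite lt_min a0 divr_gt0 // mulr_gt0.
have ra : rho <= a by rewrite ge_min lexx.
have Qr : Q * rho <= 1 / 2.
  have : rho <= 1 / (2 * Q) by rewrite ge_min lexx orbT.
  move=> /(ler_wpM2l (ltW Q0)) h; rewrite (le_trans h) // le_eqVlt; apply/orP; left.
  by apply/eqP; field; rewrite lt0r_neq0.
pose A := `|rb|; have A0 : 0 <= A by exact: normr_ge0.
have OA x c : Omega x -> `|x 0 c| <= A.
  by move=> /Orb xr; rewrite (le_trans (coord_le_enorm _ _)) // (le_trans xr) // ler_norm.
have [M ME] : exists z, z = expR (d%:R * (eta * ((A + (A + 1)) * (A + (A + 1))))) by eexists.
have M0 : 0 <= M by rewrite ME expR_ge0.
have [C CE] : exists z, z = 1 + 8 * k%:R * Num.sqrt M by eexists.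
have C1 : 1 <= C by rewrite CE lerDl !mulr_ge0 // sqrtr_ge0.
have kp : 0 < k%:R :> R by rewrite ltr0n.
(* The largest value of N^(5/2) h that [step_size_bound] admits. *)
have [ka kaE] : exists z, z = rho / (2 * (k%:R * 64 * 16) * L) by eexists.
have ka0 : 0 < ka by rewrite kaE divr_gt0 // !mulr_gt0.
(* The condition h <= ka / D means X = (ka / h)^(2/5) >= 2 (C + 1). Since N > X - 1, this gives C -
   N <= - X / 2, so half of the decay absorbs the prefactor C <= e^C. *)
have [D DE] : exists z, z = (2 * (C + 1)) `^ (5 / 2) by eexists.
have D1 : 1 <= D by rewrite DE -[leLHS](powRr0 (2 * (C + 1))) ler_powR //; lra.
have Dp : 0 < D by lra.
pose h0 := Num.min rho (ka / D).
exists (ka `^ (2 / 5) / 2), h0; split.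
- by rewrite divr_gt0 // powR_gt0.
- by rewrite lt_min r0 divr_gt0.
move=> h /andP[hp]; rewrite le_min => /andP[hr hD] g S S0 gS dense y Oy.
have [X XE] : exists z, z = (ka / h) `^ (2 / 5) by eexists.
have kh0 : 0 < ka / h by rewrite divr_gt0.
have X52 : X `^ (5 / 2) = ka / h.
  rewrite XE -powRrM (_ : 2 / 5 * (5 / 2) = 1) ?powRr1 //; first exact: ltW.
  by field.
have DX : 2 * (C + 1) <= X.
  have e : 2 * (C + 1) = D `^ (2 / 5).
    rewrite DE -powRrM (_ : 5 / 2 * (2 / 5) = 1) ?powRr1 //; first by lra.
    by field.
  rewrite e XE ge0_ler_powR ?nnegrE ?(ltW Dp) ?(ltW kh0) ?divr_ge0 //.
  by rewrite ler_pdivlMr // mulrC -ler_pdivlMr.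
pose N := Num.truncn X.
have X0 : 0 <= X by lra.
have NX : N%:R <= X by rewrite truncn_le.
have XN : X < N%:R + 1 by rewrite natr1 truncnS_gt.
have N0 : (0 < N)%N.
  by rewrite -(@ltr_nat R); lra.
have N1 : 1 <= N%:R :> R by rewrite ler1n.
have small : k%:R * 64 * (16 * N%:R * N.+1%:R * (L * h) / rho * Num.sqrt N%:R) <= 1.
  have Nbound : N%:R ^+ 2 * Num.sqrt N%:R <= ka / h :> R.
    by rewrite -powR_half5 // -X52 ge0_ler_powR ?nnegrE ?divr_ge0.
  rewrite -[N.+1%:R]natr1; apply: step_size_bound; rewrite ?sqrtr_ge0 //.
  move: Nbound; rewrite kaE -mulrA -invfM ler_pdivlMr ?mulr_gt0 //.
have [j [u0 [Eu0 Bu0 H]]] := good y Oy rho ltac:(by rewrite r0 ra).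
have [_ _ _ /(_ j) [_ sInv _ InvB]] := atl.
have [Uo _ _ _] := atl; have [Oj [_ UE]] := Uo j.
have OInv u : open_eball (r j) u -> Omega (Psi_inv j u).
  by move=> /InvB[]; rewrite UE => -[].
have rbox u : in_box u0 rho u -> in_box u0 (2 * rho) u.
  by move=> b c; rewrite (le_trans (b c)) // ler_peMl ?(ltW r0) // ler1n.
(* The expansion moves by up to rho along an axis from a point of the rho-box; hence the radius 2
   rho in [good_chart]. *)
have axbox u i s : in_box u0 rho u -> `|s| <= rho -> in_box u0 (2 * rho) (u + s *: delta_mx 0 i).
  move=> b sr c; rewrite axis_coord addrAC (le_trans (ler_normD _ _)) //.
  have : `|s * (c == i)%:R| <= rho.
    by rewrite normrM normr_nat; case: eqP; rewrite ?mulr1 ?mulr0 // ltW.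
  by have := b c; lra.
have small' : `|g (Psi_inv j u0)| <= S * C * (1 / 4) ^+ N.
  rewrite CE; apply: (@dense_zeros_small _ _ (gaussian eta) g k S M rho (L * h)) => //.
  - by rewrite mulr_ge0 // ltW.
  - by move=> x; rewrite /gaussian subrr enorm0 expr0n mulr0 expR0.
  - move=> u i s' bu sr; rewrite ME; apply: (@wiener_gaussian _ _ _ (r j) Q A) => //.
    + exact: ltW.
    + by move=> s ss; apply: Bu0; apply: axbox.
    + by move=> c; apply/OA/OInv/Bu0/rbox.
    + by move=> c; apply/OA/OInv/Bu0/axbox.
  - move=> u /rbox bu; have [x [Ox gx xh]] := dense _ (OInv _ (Bu0 _ bu)).
    have [v vx bv] := H u x bu Ox (le_trans xh hr).
    exists v; last by rewrite vx.
    by move=> c; rewrite (le_trans (bv c)) // ler_wpM2l // ltW.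
rewrite -Eu0 (le_trans small') // [leRHS]mulrC -mulrA ler_wpM2l //.
have e4 : (1 / 4 : R) ^+ N <= expR (- N%:R).
  have -> : - N%:R = -1 * N%:R :> R by rewrite mulN1r.
  rewrite expRM_natr lerXn2r ?nnegrE ?expR_ge0 ?divr_ge0 //.
  exact: expRN1_quarter.
have eC : C <= expR C by rewrite (le_trans _ (expR_ge1Dx _)) // lerDr.
apply: (@le_trans _ _ (expR C * expR (- N%:R))).
  apply: ler_pM; [exact: le_trans ler01 C1 | by rewrite exprn_ge0 ?divr_ge0 | exact: eC | exact: e4].
rewrite -expRD ler_expR.
have -> : - (ka `^ (2 / 5) / 2) * h `^ (- (2 / 5)) = - (X / 2).
  rewrite XE (@powRM _ ka h^-1) ?invr_ge0 ?(ltW ka0) ?(ltW hp) // powRN.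
  rewrite -[h^-1]powR_inv1 ?(ltW hp) // -powRrM mulN1r powRN; ring.
lra.
Qed.

(** * The Gaussian kernel and its interpolants *)

Lemma gaussian_sym (R : realType) d eta (x y : 'rV[R]_d) : gaussian eta x y = gaussian eta y x.
Proof. by rewrite /gaussian -enormN opprB. Qed.

Lemma gaussian_diag (R : realType) d eta (x : 'rV[R]_d) : gaussian eta x x = 1.
Proof. by rewrite /gaussian subrr enorm0 expr0n mulr0 expR0. Qed.

Definition dotv (R : realType) d (x y : 'rV[R]_d) : R := \sum_c x 0 c * y 0 c.

Lemma gaussian_factor (R : realType) d eta (x y : 'rV[R]_d) :
  gaussian eta x y =
  expR (- eta * enorm x ^+ 2) * expR (- eta * enorm y ^+ 2) * expR (2 * eta * dotv x y).
Proof.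
rewrite /gaussian -!expRD; congr expR; rewrite !sqr_enorm /dotv !mulr_sumr -!big_split /=.
by apply: eq_bigr => c _; rewrite !mxE; ring.
Qed.

(** One factor of the inner product is split into coordinates, which are absorbed into the
    coefficients a; for exponent 0 the form is a square. *)
Lemma dotv_pow_psd (R : realType) d m n (a : 'I_m -> R) (p : 'I_m -> 'rV[R]_d) :
  0 <= \sum_i a i * \sum_j a j * dotv (p i) (p j) ^+ n.
Proof.
elim: n a => [|n IH] a.
  under eq_bigr => i _ do under eq_bigr => j _ do rewrite expr0 mulr1.
  by rewrite -mulr_suml -expr2 sqr_ge0.
have -> : \sum_i a i * \sum_j a j * dotv (p i) (p j) ^+ n.+1 =
    \sum_c \sum_i (a i * p i 0 c) * \sum_j (a j * p j 0 c) * dotv (p i) (p j) ^+ n.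
  rewrite exchange_big /=; apply: eq_bigr => i _.
  under [RHS]eq_bigr => c _ do rewrite mulr_sumr.
  rewrite exchange_big /= mulr_sumr; apply: eq_bigr => j _.
  rewrite exprS {1}/dotv mulr_suml !mulr_sumr; apply: eq_bigr => c _; ring.
by apply: sumr_ge0 => c _; exact: IH.
Qed.

(** Once the factors depending on a single point are absorbed into a, the kernel is exp (2 eta <x,
    y>), a limit of combinations of powers of <x, y> with nonnegative coefficients. *)
Lemma gaussian_psd (R : realType) d eta m (a : 'I_m -> R) (p : 'I_m -> 'rV[R]_d) :
  0 <= eta -> 0 <= gram (gaussian eta) a p.
Proof.
move=> eta0; pose b i := a i * expR (- eta * enorm (p i) ^+ 2).
have -> : gram (gaussian eta) a p = \sum_i b i * \sum_j b j * expR (2 * eta * dotv (p i) (p j)).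
  apply: eq_bigr => i _; rewrite /b -mulrA; congr (_ * _); rewrite mulr_sumr.
  by apply: eq_bigr => j _; rewrite gaussian_factor; ring.
have cv i j : (series (exp_coeff (2 * eta * dotv (p i) (p j)))) @ \oo -->
    expR (2 * eta * dotv (p i) (p j)) by exact: is_cvg_series_exp_coeff.
have cs : (\sum_i b i * \sum_j b j * series (exp_coeff (2 * eta * dotv (p i) (p j))) n) @[n --> \oo]
    --> \sum_i b i * \sum_j b j * expR (2 * eta * dotv (p i) (p j)).
  apply: cvg_big => [|i _]; first exact: add_continuous.
  apply: cvgMr; apply: cvg_big => [|j _]; first exact: add_continuous.
  by apply: cvgMr; exact: cv.
rewrite -(cvg_lim _ cs) //; apply: limr_ge; first by apply/cvg_ex; eexists; exact: cs.
near=> n; rewrite /series /=.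
have -> : \sum_i b i * \sum_j b j * \sum_(0 <= l < n) exp_coeff (2 * eta * dotv (p i) (p j)) l =
   \sum_(0 <= l < n) ((2 * eta) ^+ l / l`!%:R) * \sum_i b i * \sum_j b j * dotv (p i) (p j) ^+ l.
  under [RHS]eq_bigr => l _ do rewrite mulr_sumr.
  rewrite exchange_big /=; apply: eq_bigr => i _.
  under [RHS]eq_bigr => l _ do rewrite mulrCA mulr_sumr.
  rewrite -mulr_sumr; congr (_ * _); rewrite exchange_big /=; apply: eq_bigr => j _.
  rewrite mulr_sumr; apply: eq_bigr => l _; rewrite /exp_coeff /= exprMn; ring.
apply: sumr_ge0 => l _; rewrite mulr_ge0 ?dotv_pow_psd // divr_ge0 // exprn_ge0 //.
by rewrite mulr_ge0.
Unshelve. all: by end_near. Qed.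

Lemma quadratic_discriminant (R : realType) (A B X : R) :
  (forall t : R, 0 <= t ^+ 2 * A + 2 * t * X + B) -> 0 <= A -> `|X| <= Num.sqrt A * Num.sqrt B.
Proof.
move=> q A0.
have B0 : 0 <= B by have := q 0; rewrite expr0n mul0r mulr0 mul0r !add0r.
rewrite -sqrtrM // -sqrtr_sqr ler_wsqrtr //.
have [A0'|An0] := eqVneq A 0.
  have [->|X0] := eqVneq X 0; first by rewrite expr0n mulr_ge0.
  (* For A = 0 the expression is affine in t, and this t would give it the value -1. *)
  have := q (- (B + 1) / (2 * X)); rewrite A0' mulr0 add0r.
  have -> : 2 * (- (B + 1) / (2 * X)) * X = - (B + 1) by field.
  lra.
have Ap : 0 < A by rewrite lt_def An0.
have := q (- X / A).
have -> : (- X / A) ^+ 2 * A + 2 * (- X / A) * X + B = (A * B - X ^+ 2) / A by field.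
by rewrite pmulr_lge0 ?invr_gt0 // subr_ge0.
Qed.

(** The discriminant of the Gram form of the concatenated family with coefficients t a and c. *)
Lemma gram_cauchy_schwarz (R : realType) (E : Type) (ker : E -> E -> R) m n
    (a : 'I_m -> R) (p : 'I_m -> E) (c : 'I_n -> R) (z : 'I_n -> E) :
  (forall l (b : 'I_l -> R) q, 0 <= gram ker b q) -> (forall x y, ker x y = ker y x) ->
  `|\sum_i a i * \sum_j c j * ker (z j) (p i)| <= Num.sqrt (gram ker a p) * Num.sqrt (gram ker c z).
Proof.
move=> psd sym; apply: quadratic_discriminant => // t.
pose b (i : 'I_(m + n)) := match fintype.split i with inl i => t * a i | inr j => c j end.
pose q (i : 'I_(m + n)) := match fintype.split i with inl i => p i | inr j => z j end.
have bl i : b (lshift n i) = t * a i by rewrite /b (unsplitK (inl i)).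
have br j : b (rshift m j) = c j by rewrite /b (unsplitK (inr j)).
have ql i : q (lshift n i) = p i by rewrite /q (unsplitK (inl i)).
have qr j : q (rshift m j) = z j by rewrite /q (unsplitK (inr j)).
have := psd _ b q; rewrite /gram big_split_ord /=.
under eq_bigr => i _.
  rewrite big_split_ord /= bl ql mulrDr.
  under eq_bigr => j _ do rewrite bl ql.
  under [X in _ + _ * X]eq_bigr => j _ do rewrite br qr sym.
  over.
under [X in 0 <= _ + X]eq_bigr => i _.
  rewrite big_split_ord /= br qr mulrDr.
  under eq_bigr => j _ do rewrite bl ql.
  under [X in _ + _ * X]eq_bigr => j _ do rewrite br qr.
  over.
rewrite !big_split /=.
have -> : \sum_(i < m) t * a i * \sum_(j < m) t * a j * ker (p i) (p j) =
    t ^+ 2 * \sum_i a i * \sum_j a j * ker (p i) (p j).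
  rewrite mulr_sumr; apply: eq_bigr => i _; rewrite !mulr_sumr.
  by apply: eq_bigr => j _; ring.
have -> : \sum_(i < m) t * a i * \sum_(j < n) c j * ker (z j) (p i) =
    t * \sum_i a i * \sum_j c j * ker (z j) (p i).
  by rewrite mulr_sumr; apply: eq_bigr => i _; ring.
have -> : \sum_(j < n) c j * \sum_(i < m) t * a i * ker (z j) (p i) =
    t * \sum_i a i * \sum_j c j * ker (z j) (p i).
  rewrite mulr_sumr; under [RHS]eq_bigr => i _ do rewrite mulr_sumr mulr_sumr.
  rewrite exchange_big /=; apply: eq_bigr => j _; rewrite mulr_sumr.
  by apply: eq_bigr => i _; ring.
by move=> h; apply: le_trans h _; rewrite le_eqVlt; apply/orP; left; apply/eqP; ring.
Qed.

Lemma native_bounded_kernel_sum (R : realType) (E : Type) (ker : E -> E -> R) n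
    (c : 'I_n -> R) (z : 'I_n -> E) :
  (forall l (b : 'I_l -> R) q, 0 <= gram ker b q) -> (forall x y, ker x y = ker y x) ->
  native_bounded ker (fun y => \sum_j c j * ker (z j) y) (Num.sqrt (gram ker c z)).
Proof. by move=> psd sym m a p; rewrite mulrC; exact: gram_cauchy_schwarz. Qed.

(* Test the relation at t x_0, where x_0 has the largest norm among the points
   with nonzero coefficient, and let t grow: the term of x_0 dominates. *)
Lemma gaussian_lin_indep (R : realType) d n eta (x : 'I_n -> 'rV[R]_d) (v : 'I_n -> R) :
  0 < eta -> injective x -> (forall z, \sum_i v i * gaussian eta (x i) z = 0) ->
  forall i, v i = 0.
Proof.
move=> eta0 xI vz i1; apply/eqP; apply: contraT => vi1.
have [i0 vi0 imax] := @arg_maxP _ _ _ i1 (fun i => v i != 0) (fun i => enorm (x i)) vi1.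
pose w i := v i * expR (- eta * enorm (x i) ^+ 2).
pose D i := enorm (x i0) ^+ 2 - dotv (x i) (x i0).
have Dp i : i != i0 -> v i != 0 -> 0 < D i.
  move=> ii vi; have xm := imax i vi.
  have e : enorm (x i0 - x i) ^+ 2 = enorm (x i0) ^+ 2 + enorm (x i) ^+ 2 - 2 * dotv (x i) (x i0).
    rewrite !sqr_enorm /dotv mulr_sumr -big_split -sumrB /=.
    by apply: eq_bigr => c _; rewrite !mxE; ring.
  have p : 0 < enorm (x i0 - x i) ^+ 2.
    rewrite lt_def sqr_ge0 andbT sqr_enorm; apply: contra ii => /eqP h.
    rewrite eq_sym -(inj_eq xI); apply/eqP/rowP => c.
    have /(_ c isT)/eqP := psumr_eq0P (fun i _ => sqr_ge0 _) h.
    by rewrite sqrf_eq0 !mxE subr_eq0 => /eqP.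
  have sq : enorm (x i) ^+ 2 <= enorm (x i0) ^+ 2 by rewrite lerXn2r ?nnegrE ?enorm_ge0.
  by rewrite /D; lra.
have w0 : 0 < `|w i0| by rewrite normr_gt0 mulf_neq0 // gt_eqF // expR_gt0.
pose C := \sum_(i | (i != i0) && (v i != 0)) `|w i| / (2 * eta * D i).
have C0 : 0 <= C.
  apply: sumr_ge0 => i /andP[ii vi]; rewrite divr_ge0 // mulr_ge0 ?(ltW (Dp _ ii vi)) //.
  by rewrite mulr_ge0 // ltW.
(* By exp (- y) <= 1 / y the terms other than that of x_0 add up to at most C / t, so this t leads
   to C + 1 <= C. *)
have [t tE] : exists t, t = (C + 1) / `|w i0| by eexists.
have t0 : 0 < t by rewrite tE divr_gt0 // ltr_wpDl.
have : \sum_i w i * expR (- (2 * eta * t * D i)) = 0.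
  have := vz (t *: x i0) => /(congr1 (fun s => s * expR (eta * enorm (t *: x i0) ^+ 2) *
     expR (- (2 * eta * t * enorm (x i0) ^+ 2)))).
  rewrite !mul0r => h; rewrite -[RHS]h !mulr_suml; apply: eq_bigr => i _.
  rewrite gaussian_factor /w -!mulrA -!expRD; congr (_ * expR _).
  have -> : dotv (x i) (t *: x i0) = t * dotv (x i) (x i0).
    by rewrite /dotv mulr_sumr; apply: eq_bigr => c _; rewrite !mxE; ring.
  by rewrite /D; ring.
rewrite (bigD1 i0) //= => /eqP; rewrite addr_eq0 => /eqP e.
have D00 : D i0 = 0.
  by rewrite /D sqr_enorm /dotv -sumrB big1 // => c _; rewrite expr2 subrr.
have : `|w i0| * t <= C.
  rewrite D00 mulr0 oppr0 expR0 mulr1 in e; rewrite e normrN -ler_pdivlMr //.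
  rewrite (le_trans (ler_norm_sum _ _ _)) // /C mulr_suml.
  rewrite [leRHS]big_mkcondr /=; apply: ler_sum => i ii.
  case: ifPn => [vi|]; last first.
    by rewrite negbK /w => /eqP ->; rewrite !mul0r normr0.
  have Di := Dp i ii vi.
  rewrite normrM -[leRHS]mulrA ler_wpM2l // ger0_norm ?expR_ge0 // expRN -invfM.
  have p : 0 < 2 * eta * t * D i by rewrite !mulr_gt0.
  rewrite lef_pV2 ?posrE ?expR_gt0 ?mulr_gt0 //.
  have := expR_ge1Dx (2 * eta * t * D i).
  have -> : 2 * eta * D i * t = 2 * eta * t * D i by ring.
  lra.
rewrite tE mulrC divfK ?lt0r_neq0 //; lra.
Qed.

(** A kernel vector v has Gram form 0, so by Cauchy-Schwarz the function \sum_i v_i k(x_i, z)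
    vanishes for every z, and linear independence gives v = 0. *)
Lemma gaussian_mx_unit (R : realType) d n eta (x : 'I_n -> 'rV[R]_d) :
  0 < eta -> injective x -> gaussian_mx eta x \in unitmx.
Proof.
move=> eta0 xI; rewrite -row_free_unit -kermx_eq0; apply: contraT => /rowV0Pn[v].
move=> /sub_kermxP vK vn0; case/eqP: vn0; apply/rowP => i; rewrite mxE.
apply: (gaussian_lin_indep eta0 xI (v := v 0)) => z.
have g0 : gram (gaussian eta) (v 0) x = 0.
  rewrite /gram big1 // => j _; have /rowP/(_ j) := vK; rewrite !mxE => h.
  rewrite (_ : \sum_j0 _ = 0) ?mulr0 // -[RHS]h; apply: eq_bigr => l _.
  by rewrite mxE gaussian_sym.
have psd l (b : 'I_l -> R) q : 0 <= gram (@gaussian R d eta) b q by apply: gaussian_psd; exact: ltW.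
have := gram_cauchy_schwarz (fun _ : 'I_1 => 1) (fun=> z) (v 0) x psd (@gaussian_sym R d eta).
by rewrite g0 sqrtr0 mulr0 big_ord1 mul1r normr_le0 => /eqP.
Qed.

Lemma interpolant_node (R : realType) d n eta (x : 'I_n -> 'rV[R]_d) f i :
  0 < eta -> injective x -> interpolant eta x f (x i) = f (x i).
Proof.
move=> eta0 xI; have u := gaussian_mx_unit eta0 xI.
have /colP/(_ i) := mulKVmx u (\col_i f (x i)); rewrite !mxE => <-.
by apply: eq_bigr => j _; rewrite !mxE mulrC.
Qed.

(** The residual is itself a finite kernel combination. As it vanishes at the nodes, its squared
    norm is its own value at x, namely 1 minus a Gram form. *)
Lemma kernel_residual_bounded (R : realType) d n eta (z : 'I_n -> 'rV[R]_d) x :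
  0 < eta -> injective z ->
  native_bounded (gaussian eta) (fun y => gaussian eta x y - interpolant eta z (gaussian eta x) y) 1.
Proof.
move=> eta0 zI.
have psd l (b : 'I_l -> R) q : 0 <= gram (@gaussian R d eta) b q by apply: gaussian_psd; exact: ltW.
pose w := invmx (gaussian_mx eta z) *m (\col_i gaussian eta x (z i)).
pose c (i : 'I_n.+1) := if unlift ord0 i is Some j then - w j 0 else 1.
pose q (i : 'I_n.+1) := if unlift ord0 i is Some j then z j else x.
have c0 : c ord0 = 1 by rewrite /c unlift_none.
have cl j : c (lift ord0 j) = - w j 0 by rewrite /c liftK.
have q0 : q ord0 = x by rewrite /q unlift_none.
have ql j : q (lift ord0 j) = z j by rewrite /q liftK.
have gE y : gaussian eta x y - interpolant eta z (gaussian eta x) y =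
    \sum_i c i * gaussian eta (q i) y.
  rewrite big_ord_recl c0 q0 mul1r /interpolant -sumrN; congr (_ + _).
  by apply: eq_bigr => j _; rewrite cl ql mulNr gaussian_sym.
have gz j : gaussian eta x (z j) - interpolant eta z (gaussian eta x) (z j) = 0.
  by rewrite interpolant_node // subrr.
have gram1 : gram (gaussian eta) c q <= 1.
  have -> : gram (gaussian eta) c q =
      \sum_i c i * (gaussian eta x (q i) - interpolant eta z (gaussian eta x) (q i)).
    by apply: eq_bigr => i _; rewrite gE; congr (_ * _); apply: eq_bigr => j _; rewrite gaussian_sym.
  rewrite big_ord_recl c0 q0 mul1r big1 ?addr0 => [|j _]; last by rewrite ql gz mulr0.
  rewrite gaussian_diag gerDl oppr_le0.
  have -> : interpolant eta z (gaussian eta x) x = gram (gaussian eta) (fun i => w i 0) z.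
    apply: eq_bigr => i _; congr (_ * _); rewrite -(interpolant_node (gaussian eta x) i eta0 zI).
    by apply: eq_bigr.
  exact: psd.
have := native_bounded_kernel_sum c q psd (@gaussian_sym R d eta) => nb m a p.
under eq_bigr => i _ do rewrite gE.
rewrite (le_trans (nb m a p)) // ler_wpM2r ?sqrtr_ge0 //.
by rewrite -[leRHS]sqrtr1 ler_wsqrtr.
Qed.

(** * Functions in a reproducing kernel Hilbert space *)

Lemma rkhs_kernel_sum (R : realType) (E : Type) (ker : E -> E -> R) (H : rkhs ker) m
    (a : 'I_m -> R) (p : 'I_m -> E) :
  car H (fun y => \sum_i a i * ker (p i) y) /\
  forall f, car H f -> dot H (fun y => \sum_i a i * ker (p i) y) f = \sum_i a i * f (p i).
Proof.
elim: m a p => [|m IH] a p.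
  have -> : (fun y => \sum_(i < 0) a i * ker (p i) y) = fun=> 0.
    by apply/funext => y; rewrite big_ord0.
  split=> [|f Hf]; first exact: rkhs0.
  have := dot_lin (-1) (rkhs0 H) (rkhs0 H) Hf.
  rewrite (_ : (fun x => -1 * 0 + 0) = fun=> 0); last by apply/funext => y; rewrite mulr0 addr0.
  by rewrite big_ord0 mulN1r addNr.
have [c1 d1] := IH (fun i => a (widen_ord (leqnSn m) i)) (fun i => p (widen_ord (leqnSn m) i)).
have -> : (fun y => \sum_i a i * ker (p i) y) = (fun y => a ord_max * ker (p ord_max) y +
    \sum_(i < m) a (widen_ord (leqnSn m) i) * ker (p (widen_ord (leqnSn m) i)) y).
  by apply/funext => y; rewrite big_ord_recr addrC.
split=> [|f Hf]; first by apply: rkhs_lin => //; exact: rkhs_ker.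
rewrite dot_lin ?d1 //; last exact: rkhs_ker.
by rewrite dot_sym ?rkhs_reproducing ?big_ord_recr 1?addrC //; exact: rkhs_ker.
Qed.

Lemma rkhs_dot_linr (R : realType) (E : Type) (ker : E -> E -> R) (H : rkhs ker) a f g h :
  car H f -> car H g -> car H h ->
  dot H h (fun x => a * f x + g x) = a * dot H h f + dot H h g.
Proof.
move=> Hf Hg Hh; rewrite dot_sym ?dot_lin //; last exact: rkhs_lin.
by rewrite (dot_sym Hf) // (dot_sym Hg).
Qed.

(** Cauchy-Schwarz in H against the representer of the functional, whose squared norm is the Gram
    form. *)
Lemma rkhs_native_bounded (R : realType) (E : Type) (ker : E -> E -> R) (H : rkhs ker) g :
  (forall x y, ker x y = ker y x) -> car H g -> native_bounded ker g (rkhs_norm H g).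
Proof.
move=> sym Hg m a p; have [Hc dc] := rkhs_kernel_sum H a p.
rewrite -(dc g Hg) mulrC.
have -> : gram ker a p = dot H (fun y => \sum_i a i * ker (p i) y) (fun y => \sum_i a i * ker (p i) y).
  by rewrite dc //; apply: eq_bigr => i _; congr (_ * _); apply: eq_bigr => j _; rewrite sym.
set f := fun y => _ in Hc *.
apply: quadratic_discriminant; last exact: dot_ge0.
move=> t; have Htf := rkhs_lin t Hc Hg; have := dot_ge0 Htf.
rewrite dot_lin // !rkhs_dot_linr // (dot_sym Hg Hc) => h; apply: le_trans h _.
by rewrite le_eqVlt; apply/orP; left; apply/eqP; ring.
Qed.

(** The interpolant I is a combination of kernels at the nodes, where the residual vanishes; so the
    two are orthogonal and Pythagoras applies. *)
Lemma interpolation_residual_norm (R : realType) d n eta (H : rkhs (@gaussian R d eta))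
    (x : 'I_n -> 'rV[R]_d) f :
  0 < eta -> injective x -> car H f ->
  car H (fun y => f y - interpolant eta x f y) /\
  rkhs_norm H (fun y => f y - interpolant eta x f y) <= rkhs_norm H f.
Proof.
move=> eta0 xI Hf.
pose c := invmx (gaussian_mx eta x) *m (\col_i f (x i)).
have [HI dI] := rkhs_kernel_sum H (fun i => c i 0) x.
have IE : (fun y => \sum_i c i 0 * gaussian eta (x i) y) = interpolant eta x f.
  by apply/funext => y; apply: eq_bigr => i _; rewrite gaussian_sym.
rewrite IE in HI dI; set I := interpolant eta x f in HI dI *.
have gE : (fun y => f y - I y) = (fun y => -1 * I y + f y).
  by apply/funext => y; rewrite mulN1r addrC.
have Hg : car H (fun y => f y - I y) by rewrite gE; exact: rkhs_lin.
set g := fun y => f y - I y in gE Hg *.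
split => //; apply: ler_wsqrtr.
have Ig : dot H I g = 0.
  by rewrite dI // big1 // => i _; rewrite /g /I interpolant_node // subrr mulr0.
have fE : f = (fun y => 1 * I y + g y) by apply/funext => y; rewrite /g mul1r addrC subrK.
have ff : dot H (fun y => 1 * I y + g y) (fun y => 1 * I y + g y) = dot H I I + dot H g g.
  have Hs := rkhs_lin 1 HI Hg.
  by rewrite dot_lin // !rkhs_dot_linr // (dot_sym Hg HI) Ig; ring.
by move: ff; rewrite -fE => ->; rewrite lerDr dot_ge0.
Qed.

(** * Eigenvalues of symmetric matrices *)

Local Open Scope sesquilinear_scope.

Lemma char_poly_conjmx (F : fieldType) n (P D : 'M[F]_n) :
  P \in unitmx -> char_poly (invmx P *m D *m P) = char_poly D.
Proof.
move=> uP; rewrite /char_poly.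
have -> : char_poly_mx (invmx P *m D *m P) =
    map_mx polyC (invmx P) *m char_poly_mx D *m map_mx polyC P.
  rewrite /char_poly_mx !map_mxM mulmxBr mulmxBl; congr (_ - _).
  by rewrite -scalemx1 -scalemxAr -scalemxAl mulmx1 -map_mxM mulVmx // map_mx1.
rewrite !det_mulmx mulrAC -det_mulmx -map_mxM mulVmx // map_mx1 det1.
by rewrite mul1r.
Qed.

(** A real symmetric matrix is hermitian over R[i]. Its eigenvalues are brought back to R but P
    remains complex, so quadratic forms are later evaluated over R[i]. *)
Lemma symmetric_spectral (R : realType) n (A : 'M[R]_n) : A^T = A ->
  exists (P : 'M[R[i]]_n) (s : 'I_n -> R),
    [/\ P \is unitarymx,
        map_mx (real_complex R) A = P^t* *m diag_mx (\row_i real_complex R (s i)) *m P &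
        char_poly A = \prod_i ('X - (s i)%:P)].
Proof.
move=> As; pose AC := map_mx (real_complex R) A.
have Areal : AC \is a realmx.
  by apply/mxOverP => i j; rewrite mxE; apply/complex_realP; exists (A i j).
have Asym : AC \is symmetricmx.
  by apply/is_hermitianmxP; rewrite expr0 scale1r; apply/matrixP => i j; rewrite !mxE -{1}As mxE.
have Aherm := realsym_hermsym Asym Areal.
have /orthomx_spectralP AE := hermitian_normalmx Aherm.
have /mxOverP dreal := hermitian_spectral_diag_real Aherm.
set P := spectralmx AC in AE; set D := spectral_diag AC in AE dreal.
have uP : P \is unitarymx by exact: spectral_unitarymx.
pose s i := complex.Re (D 0 i).
have DE : D = \row_i real_complex R (s i).
  by apply/rowP => i; rewrite mxE RRe_real.
exists P, s; split => //; first by rewrite -invmx_unitary // -DE.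
apply: (@map_poly_inj _ _ (real_complex R)).
rewrite map_char_poly -/AC AE char_poly_conjmx ?unitarymx_unit //.
rewrite char_poly_trig; last by apply/diag_mx_is_trig.
rewrite rmorph_prod; apply: eq_bigr => i _.
by rewrite rmorphB /= map_polyX map_polyC /= DE !mxE eqxx mulr1n.
Qed.

Lemma eigenvalues_perm (R : realType) n (A : 'M[R]_n) (s : 'I_n -> R) :
  char_poly A = \prod_i ('X - (s i)%:P) -> perm_eq (eigenvalues A) (codom s).
Proof.
move=> cE; rewrite /eigenvalues perm_sort; apply/permP => f.
have p0 : char_poly A != 0 by rewrite monic_neq0 // char_poly_monic.
suff /permP : perm_eq (flatten [seq nseq (mup a (char_poly A)) a | a <- rootsR (char_poly A)]) (codom s).
  exact.
apply/allP => a _ /=; apply/eqP.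
have -> : count_mem a (codom s) = mup a (char_poly A).
  by rewrite cE -(mu_prod_XsubC a (codom s)) big_map enumT.
have H (t : seq R) : uniq t ->
    count_mem a (flatten [seq nseq (mup b (char_poly A)) b | b <- t]) =
    if a \in t then mup a (char_poly A) else 0%N.
  elim: t => //= b t IH /andP[bt /IH H]; rewrite count_cat H count_nseq in_cons /=.
  case: (eqVneq b a) => [E|ba].
    by rewrite E in bt *; rewrite (negPf bt) /= ?eqxx ?mul1n ?addn0.
  by rewrite /= mul0n add0n.
rewrite H; last exact: uniq_roots.
have := roots_on_rootsR p0 a; rewrite in_itv /= => <-.
by case: ifPn => // /mupNroot ->.
Qed.

(** If entry p exceeded e, so would the p + 1 first entries of the nonincreasing list; past its end
    the default 0 is covered by 0 <= e. *)
Lemma nth_sorted_le (R : realType) (s : seq R) (e : R) p : 0 <= e ->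
  (count (fun x => (e < x)%R) s <= p)%N -> nth 0 (sort >=%R s) p <= e.
Proof.
have /permP sE : perm_eq (sort >=%R s) s by rewrite perm_sort.
move=> e0; rewrite -sE => cp.
have srt : sorted >=%R (sort >=%R s) by apply: sort_sorted; exact: ge_total.
set t := sort _ s in cp srt *.
have [pt|/(nth_default 0) -> //] := ltnP p (size t).
rewrite leNgt; apply/negP => ep.
have : (p < count (fun x => (e < x)%R) t)%N; last by rewrite ltnNge cp.
have : all (fun x => e < x) (take p.+1 t).
  apply/(all_nthP 0) => i; rewrite size_takel // => ip; rewrite nth_take //.
  apply: lt_le_trans ep _.
  have := sorted_leq_nth (@ge_trans _ R) (@ge_refl _ R) 0 srt; apply.
  - by rewrite inE (leq_trans ip).
  - by rewrite inE.
  - exact: ip.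
rewrite all_count size_takel // => /eqP cE.
by rewrite -(cat_take_drop p.+1 t) count_cat cE leq_addr.
Qed.

Lemma eig_le_of_card (R : realType) n (A : 'M[R]_n) (s : 'I_n -> R) (e : R) p :
  char_poly A = \prod_i ('X - (s i)%:P) -> 0 <= e ->
  (#|[pred i | (e < s i)%R]| <= p)%N -> eig A p.+1 <= e.
Proof.
move=> /eigenvalues_perm pE e0 cp; rewrite /eig /= /eigenvalues; apply: nth_sorted_le => //.
move: pE; rewrite /eigenvalues perm_sort => /permP ->.
by rewrite -sum1_count big_image_cond /= sum1_card.
Qed.

(* Too many large eigenvalues would leave a combination v of their eigenvectors
   with v W = 0, on which the quadratic forms of A and E coincide. *)
Lemma low_rank_card (R : realType) n p (A : 'M[R]_n) (P : 'M[R[i]]_n) (s : 'I_n -> R)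
    (W : 'M[R]_(n, p)) (G : 'M[R]_(p, n)) (E : 'M[R]_n) (delta : R) :
  P \is unitarymx ->
  map_mx (real_complex R) A = P^t* *m diag_mx (\row_i real_complex R (s i)) *m P ->
  A = W *m G + E -> 0 <= delta -> (forall i j, `|E i j| <= delta) ->
  (#|[pred i | (n%:R * delta < s i)%R]| <= p)%N.
Proof.
move=> uP AE AWE d0 Ed; set I := [pred i | _]; rewrite leqNgt; apply/negP => pI.
pose toC := real_complex R.
pose S : 'M[R[i]]_(#|I|, n) := \matrix_(a, i) (enum_val a == i)%:R.
pose B := S *m P *m map_mx toC W.
have /rowV0Pn[c /sub_kermxP cB cn0] : kermx B != 0.
  rewrite kermx_eq0 /row_free; apply: contraTneq pI => <-.
  by rewrite -leqNgt rank_leq_col.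
pose b := c *m S.
have bE a : b 0 (enum_val a) = c 0 a.
  rewrite mxE (bigD1 a) //= !mxE eqxx mulr1 big1 ?addr0 // => a' a'a.
  by rewrite mxE (inj_eq enum_val_inj) (negPf a'a) mulr0.
have b0 i : i \notin I -> b 0 i = 0.
  move=> iI; rewrite mxE big1 // => a _; rewrite mxE.
  case: eqP => [E1|_]; last by rewrite mulr0.
  by rewrite -E1 enum_valP in iI.
pose v := b *m P.
have vW : v *m map_mx toC W = 0 by rewrite /v /b -!mulmxA mulmxA -cB /B !mulmxA.
have vv : (v *m v^t*) 0 0 = \sum_i `|b 0 i| ^+ 2.
  rewrite /v trmx_mul map_mxM mulmxA mulmxtVK // mxE.
  by apply: eq_bigr => i _; rewrite !mxE normCK.
have vv' : (v *m v^t*) 0 0 = \sum_i `|v 0 i| ^+ 2.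
  by rewrite mxE; apply: eq_bigr => i _; rewrite !mxE normCK.
have vAv : (v *m map_mx toC A *m v^t*) 0 0 = \sum_i toC (s i) * `|b 0 i| ^+ 2.
  rewrite AE /v trmx_mul map_mxM !mulmxA mulmxtVK // -mulmxA mulmxA.
  rewrite -[_ *m P *m _]mulmxA (unitarymxP uP) mulmx1.
  rewrite mxE; apply: eq_bigr => i _.
  by rewrite mul_mx_diag !mxE normCK mulrAC mulrC mulrA.
have vEv : v *m map_mx toC A *m v^t* = v *m map_mx toC E *m v^t*.
  by rewrite AWE map_mxD map_mxM mulmxDr mulmxA vW mul0mx add0r.
clearbody v.
have [a ca0] : exists a, c 0 a != 0.
  apply/existsP; apply: contraNT cn0; rewrite negb_exists => /forallP h.
  by apply/eqP/rowP => a; rewrite mxE; apply/eqP; rewrite -[_ == _]negbK h.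
have toC_ge0 x : 0 <= x -> 0 <= toC x by rewrite ler0c.
have lt : toC (n%:R * delta) * \sum_i `|v 0 i| ^+ 2 < \sum_i toC (s i) * `|b 0 i| ^+ 2.
  rewrite -vv' vv mulr_sumr -subr_gt0 -sumrB (bigD1 (enum_val a)) //=.
  apply: ltr_wpDr.
    apply: sumr_ge0 => i _; rewrite -mulrBl -rmorphB.
    have [iI|/b0 ->] := boolP (i \in I); last by rewrite normr0 expr0n mulr0.
    rewrite mulr_ge0 ?exprn_ge0 //; apply: toC_ge0; by rewrite subr_ge0 ltW.
  rewrite -mulrBl -rmorphB mulr_gt0 //.
    by rewrite -(rmorph0 toC) ltcR subr_gt0; have := enum_valP a; rewrite inE.
  by rewrite exprn_gt0 // normr_gt0 bE.
have sum_ge0 : 0 <= toC (n%:R * delta) * \sum_i `|v 0 i| ^+ 2.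
  apply: mulr_ge0; first by apply: toC_ge0; rewrite mulr_ge0.
  by apply: sumr_ge0 => i _; rewrite exprn_ge0.
have : \sum_i toC (s i) * `|b 0 i| ^+ 2 <= toC (n%:R * delta) * \sum_i `|v 0 i| ^+ 2; last first.
  by move=> /(lt_le_trans lt); rewrite ltxx.
rewrite -[leLHS]ger0_norm; last by rewrite (le_trans sum_ge0) // ltW.
(* The form of E is at most delta \sum_i \sum_j |v_i| |v_j| <= n delta \sum_i |v_i|^2, by 2 x y <=
   x^2 + y^2. The moduli are rewritten as real numbers [m i] for the last inequality. *)
rewrite -vAv vEv -mulmxA mxE (le_trans (ler_norm_sum _ _ _)) //.
apply: (@le_trans _ _ (\sum_i \sum_j toC delta * (`|v 0 i| * `|v 0 j|))).
  apply: ler_sum => i _; rewrite normrM mxE.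
  rewrite (le_trans (ler_wpM2l _ (ler_norm_sum _ _ _))) // mulr_sumr.
  apply: ler_sum => j _; rewrite !mxE normrM norm_conjC mulrCA ler_wpM2r ?mulr_ge0 //.
  by rewrite normc_def /= expr0n addr0 sqrtr_sqr lecR.
pose m i : R := complex.Re `|v 0 i|.
have mE i : `|v 0 i| = toC (m i) by exact/esym/RRe_real/normr_real.
under eq_bigr => i _ do under eq_bigr => j _ do rewrite !mE -!rmorphM.
under [X in _ <= _ * X]eq_bigr => i _ do rewrite mE -rmorphXn.
under eq_bigr => i _ do rewrite -rmorph_sum.
rewrite -!rmorph_sum -rmorphM lecR.
under eq_bigr => i _ do rewrite -mulr_sumr.
rewrite -mulr_sumr [n%:R * _]mulrC -mulrA ler_wpM2l //.
apply: (@le_trans _ _ (\sum_i \sum_j (m i ^+ 2 + m j ^+ 2) / 2)).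
  apply: ler_sum => i _; apply: ler_sum => j _.
  by have := sqr_ge0 (m i - m j); lra.
under eq_bigr => i _.
  rewrite -mulr_suml big_split /= sumr_const card_ord -[m i ^+ 2 *+ n]mulr_natl.
  over.
rewrite -mulr_suml big_split /= -mulr_sumr sumr_const card_ord -[_ *+ n]mulr_natl.
by rewrite le_eqVlt; apply/orP; left; apply/eqP; field.
Qed.

Lemma char_poly_trace_sum (R : realType) n (A : 'M[R]_n) (s : 'I_n -> R) : (0 < n)%N ->
  char_poly A = \prod_i ('X - (s i)%:P) -> \sum_i s i = \tr A.
Proof.
move=> n0 cE; have := char_poly_trace A n0; rewrite cE => /eqP.
have -> : \prod_(i < n) ('X - (s i)%:P) = \prod_(a <- codom s) ('X - a%:P).
  by rewrite big_map enumT.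
have sz : size (codom s) = n by rewrite size_codom card_ord.
have c := @coefPn_prod_XsubC R (codom s); rewrite sz -lt0n in c; rewrite (c n0).
by rewrite eqr_opp big_map enumT => /eqP.
Qed.

Lemma psd_roots_ge0 (R : realType) n (A : 'M[R]_n) (s : 'I_n -> R) :
  char_poly A = \prod_i ('X - (s i)%:P) ->
  (forall a : 'I_n -> R, 0 <= \sum_i a i * \sum_j a j * A i j) -> forall i, 0 <= s i.
Proof.
move=> cE psd i.
have : eigenvalue A (s i).
  by rewrite eigenvalue_root_char cE rootE horner_prod (bigD1 i) //= hornerXsubC subrr mul0r.
case/eigenvalueP => v vA vn0.
have h : \sum_j v 0 j * \sum_l v 0 l * A j l = s i * \sum_j v 0 j ^+ 2.
  rewrite (eq_bigr (fun j => \sum_l v 0 j * A j l * v 0 l)); last first.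
    by move=> j _; rewrite mulr_sumr; apply: eq_bigr => l _; ring.
  rewrite exchange_big /= mulr_sumr; apply: eq_bigr => l _.
  have /rowP/(_ l) := vA; rewrite !mxE -mulr_suml => ->; ring.
have vp : 0 < \sum_j v 0 j ^+ 2.
  rewrite lt_def sumr_ge0 ?andbT => [|j _]; last exact: sqr_ge0.
  apply: contra vn0 => /eqP e; apply/eqP/rowP => j.
  have /(_ j isT)/eqP := psumr_eq0P (fun i _ => sqr_ge0 (v 0 i)) e.
  by rewrite sqrf_eq0 mxE => /eqP.
by have := psd (v 0); rewrite h pmulr_lge0.
Qed.

(** * Interpolation error and nets *)

Lemma interpolation_error (R : realType) (d n : nat) (eta : R) (Omega : set 'rV[R]_d)
    (x : 'I_n -> 'rV[R]_d) (H : rkhs (@gaussian R d eta)) (h e : R) (f : 'rV[R]_d -> R) y :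
  0 < eta -> injective x -> (forall i, Omega (x i)) -> car H f -> 0 <= e ->
  (forall g S, 0 <= S -> native_bounded (@gaussian R d eta) g S ->
    (forall y, Omega y -> exists x, [/\ Omega x, g x = 0 & enorm (x - y) <= h]) ->
    forall y, Omega y -> `|g y| <= e * S) ->
  (forall y, Omega y -> exists i, enorm (x i - y) <= h) ->
  Omega y -> `|f y - interpolant eta x f y| <= e * rkhs_norm H f.
Proof.
move=> eta0 xI Ox Hf e0 decay dense Oy.
have [Hg gf] := interpolation_residual_norm eta0 xI Hf.
apply: (@le_trans _ _ (e * rkhs_norm H (fun y => f y - interpolant eta x f y))); last first.
  by rewrite ler_wpM2l.
apply: (decay (fun y => f y - interpolant eta x f y)) => //; first exact: sqrtr_ge0.
  exact: rkhs_native_bounded (@gaussian_sym R d eta) Hg.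
move=> z Oz; have [i hi] := dense z Oz.
by exists (x i); split => //; rewrite interpolant_node // subrr.
Qed.

(** The infimum over finitely many nodes is attained, and the ball containing Omega bounds the set
    under [sup], so that [sup] is a genuine upper bound. *)
Lemma fill_distanceP (R : realType) (d n : nat) (rb : R) (Omega : set 'rV[R]_d)
    (x : 'I_n -> 'rV[R]_d) y :
  (0 < n)%N -> Omega `<=` closed_eball rb -> (forall i, Omega (x i)) -> Omega y ->
  exists i, enorm (x i - y) <= fill_distance (range x) Omega.
Proof.
move=> n0 Orb Ox Oy; pose o := Ordinal n0.
have [i _ imin] := @arg_minP _ _ _ o xpredT (fun i => enorm (x i - y)) isT.
exists i; apply: (@le_trans _ _ (inf [set enorm (z - y) | z in range x])).
  apply: lb_le_inf; first by exists (enorm (x o - y)); exists (x o) => //; exists o.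
  by move=> _ [_ [j _ <-] <-]; exact: imin.
have hlb z : has_lbound [set enorm (w - z) | w in range x].
  by exists 0 => _ [w _ <-]; exact: enorm_ge0.
apply: sup_upper_bound; last by exists y.
split; first by exists (inf [set enorm (z - y) | z in range x]); exists y.
exists (d%:R * (2 * rb)) => _ [z Oz <-].
apply: (@le_trans _ _ (enorm (x o - z))).
  by apply: ge_inf => //; exists (x o) => //; exists o.
apply: enorm_le_sup => c; rewrite !mxE.
have := coord_le_enorm (x o) c; have := coord_le_enorm z c.
have := Orb _ (Ox o); have := Orb _ Oz; rewrite /closed_eball /=.
by have := ler_normB (x o 0 c) (z 0 c); lra.
Qed.

Lemma fill_distance_ge0 (R : realType) (d n : nat) (rb : R) (Omega : set 'rV[R]_d)
    (x : 'I_n -> 'rV[R]_d) :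
  (0 < n)%N -> Omega `<=` closed_eball rb -> (forall i, Omega (x i)) ->
  0 <= fill_distance (range x) Omega.
Proof.
move=> n0 Orb Ox; have [i h] := fill_distanceP n0 Orb Ox (Ox (Ordinal n0)).
exact: le_trans (enorm_ge0 _) h.
Qed.

Lemma enorm_eq0 (R : realType) m (x : 'rV[R]_m) : enorm x <= 0 -> x = 0.
Proof.
move=> x0; apply/rowP => c; rewrite mxE; apply/eqP; rewrite -normr_le0.
exact: le_trans (coord_le_enorm _ _) x0.
Qed.

Lemma chart_lipschitz (R : realType) (d k : nat) (r Q : R) (f : 'rV[R]_k -> 'rV[R]_d) (u v : 'rV[R]_k) :
  smooth_on (open_eball r) f -> chart_bound r Q f -> 0 < Q ->
  open_eball r u -> (forall c, `|v 0 c| <= `|u 0 c|) ->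
  forall c, `|f v 0 c - f u 0 c| <= Q * \sum_l `|v 0 l - u 0 l|.
Proof.
move=> sf bf Q0 ru vu c; rewrite mulr_sumr.
apply: (@axis_path_bound _ _ (fun z => f z 0 c)) => l w wE wl.
set T := v 0 l - u 0 l.
have inb t : 0 <= t <= 1 -> open_eball r (w + (t * T) *: delta_mx 0 l).
  move=> /andP[t0 t1]; apply: le_lt_trans ru; apply: ler_wsqrtr; apply: ler_sum => j _.
  rewrite -[leLHS]real_normK ?num_real // -[leRHS]real_normK ?num_real //.
  rewrite lerXn2r ?nnegrE // axis_coord.
  have [->|jl] := eqVneq j l; last first.
    by rewrite mulr0 addr0; case: (wE j) => -> //; exact: vu.
  rewrite mulr1 wl.
  have -> : u 0 l + t * T = (1 - t) * u 0 l + t * v 0 l by rewrite /T; ring.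
  rewrite (le_trans (ler_normD _ _)) // !normrM (ger0_norm t0) ger0_norm ?subr_ge0 //.
  have h := ler_wpM2l t0 (vu l); lra.
have := @mean_value_bound _ (fun t => f (w + t *: delta_mx 0 l) 0 c)
  (fun t => partial l f (w + t *: delta_mx 0 l) 0 c) T Q.
rewrite scale0r addr0; apply.
  move=> t t01; apply: is_derive_line.
  apply: (@smooth_on_derivable _ _ _ (open_eball r) f _ sf [::]); last exact: inb.
  exact: open_open_eball.
move=> t t01; rewrite (le_trans (coord_le_enorm _ _)) //.
by have := bf 1%N l _ isT (inb t t01); rewrite expr1.
Qed.

(* Grid points are obtained by rounding coordinates towards 0, so that they stay
   in the ball together with the axis-parallel path from the rounded point. *)
Lemma atlas_net (R : realType) (d k : nat) (Omega : set 'rV[R]_d)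
    (T : nat) (U : 'I_T -> set 'rV[R]_d) (r : 'I_T -> R)
    (Psi : 'I_T -> 'rV[R]_d -> 'rV[R]_k) (Psi_inv : 'I_T -> 'rV[R]_k -> 'rV[R]_d) (Q : R) :
  ball_atlas Omega U r Psi Psi_inv -> 0 < Q ->
  (forall j, chart_bound (r j) Q (Psi_inv j)) ->
  exists2 C : R, 0 < C & forall m, (0 < m)%N -> exists z : seq 'rV[R]_d,
    [/\ (size z <= T * (2 * m).+1 ^ k)%N, uniq z, forall x, x \in z -> Omega x &
        forall y, Omega y -> exists2 x, x \in z & enorm (x - y) <= C / m%:R].
Proof.
move=> [Uo cov rpos dif] Q0 cb.
pose rm := \sum_j r j.
have rrm j : r j <= rm.
  by rewrite /rm (bigD1 j) //= lerDl sumr_ge0 // => i _; exact: ltW.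
have rm0 : 0 <= rm by apply: sumr_ge0 => j _; exact: ltW.
(* The summand 1 keeps C positive even when rm = 0, as it is for T = 0. *)
exists (d%:R * (Q * (k%:R * rm)) + 1).
  by rewrite ltr_wpDl // !mulr_ge0 // ltW.
move=> m m0.
have mp : 0 < m%:R :> R by rewrite ltr0n.
(* The indices 0, ..., 2m encode the integers -m, ..., m. *)
pose gridp (j : 'I_T) (a : {ffun 'I_k -> 'I_(2 * m).+1}) : 'rV[R]_k :=
  \row_c (r j * ((a c)%:R - m%:R) / m%:R).
pose all_pts := [seq ja : 'I_T * {ffun 'I_k -> 'I_(2 * m).+1} <- enum {: _} |
   `[< open_eball (r ja.1) (gridp ja.1 ja.2) >]].
pose z := undup [seq Psi_inv ja.1 (gridp ja.1 ja.2) | ja <- all_pts].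
have OInv j u : open_eball (r j) u -> Omega (Psi_inv j u).
  have [_ _ _ InvB] := dif j; have [Oj [_ UE]] := Uo j.
  by move=> /InvB[]; rewrite UE => -[].
exists z; split.
- rewrite (leq_trans (size_undup _)) // size_map size_filter (leq_trans (count_size _ _)) //.
  by rewrite -cardE card_prod card_ffun !card_ord.
- exact: undup_uniq.
- move=> x; rewrite mem_undup => /mapP[[j a]]; rewrite mem_filter => /andP[/asboolP B _] ->.
  exact: OInv.
move=> y Oy; have [j _ Ujy] := cov y Oy.
have [_ sInv PsiU _] := dif j; have [Bu Pu] := PsiU y Ujy.
set u := Psi j y in Bu Pu.
have rj := rpos j.
have ur c : `|u 0 c| <= r j by rewrite (le_trans (coord_le_enorm _ _)) // ltW.
pose q c := Num.truncn (m%:R * `|u 0 c| / r j).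
have q1 c : (q c)%:R <= m%:R * `|u 0 c| / r j.
  by rewrite truncn_le divr_ge0 ?mulr_ge0 // ltW.
have q2 c : m%:R * `|u 0 c| / r j < (q c)%:R + 1 by rewrite natr1 truncnS_gt.
have qm c : (q c <= m)%N.
  by rewrite -(ler_nat R) (le_trans (q1 c)) // ler_pdivrMr // ler_wpM2l.
pose a : {ffun 'I_k -> 'I_(2 * m).+1} :=
  [ffun c => inord (if 0 <= u 0 c then (m + q c)%N else (m - q c)%N)].
have aE c : (a c)%:R - m%:R = (if 0 <= u 0 c then (q c)%:R else - (q c)%:R) :> R.
  rewrite ffunE inordK; last by have := qm c; case: ifP => _; lia.
  by case: ifP => _; rewrite ?natrD ?natrB ?qm //; ring.
set v := gridp j a.
have vE c : v 0 c = (if 0 <= u 0 c then 1 else -1) * (r j * (q c)%:R / m%:R).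
  by rewrite mxE aE; case: ifP => _; ring.
have uE c : u 0 c = (if 0 <= u 0 c then 1 else -1) * `|u 0 c|.
  case: ifPn => [h|]; first by rewrite mul1r ger0_norm.
  by rewrite -ltNge => h; rewrite mulN1r ltr0_norm // opprK.
have qu c : r j * (q c)%:R / m%:R <= `|u 0 c|.
  rewrite ler_pdivrMr // mulrC [leRHS]mulrC -ler_pdivlMr //; exact: q1.
have qu2 c : `|u 0 c| - r j * (q c)%:R / m%:R <= r j / m%:R.
  have := ltW (q2 c); rewrite ler_pdivrMr // => h.
  rewrite lerBlDr -mulrDl ler_pdivlMr //; lra.
have q0 c : 0 <= r j * (q c)%:R / m%:R by rewrite divr_ge0 // mulr_ge0 // ltW.
have sgn c : `|(if 0 <= u 0 c then 1 else -1) : R| = 1 by case: ifP; rewrite ?normrN1 ?normr1.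
have vu c : `|v 0 c| <= `|u 0 c| by rewrite vE normrM sgn mul1r ger0_norm.
have vd c : `|v 0 c - u 0 c| <= rm / m%:R.
  rewrite vE [in X in _ - X]uE -mulrBr normrM sgn mul1r distrC ger0_norm ?subr_ge0 //.
  by rewrite (le_trans (qu2 c)) // ler_wpM2r ?invr_ge0 // ltW.
have Bv : open_eball (r j) v.
  apply: le_lt_trans Bu; apply: ler_wsqrtr; apply: ler_sum => c _.
  rewrite -[leLHS]real_normK ?num_real // -[leRHS]real_normK ?num_real //.
  by rewrite lerXn2r ?nnegrE.
exists (Psi_inv j v).
  rewrite mem_undup; apply/mapP; exists (j, a) => //.
  by rewrite mem_filter mem_enum andbT; apply/asboolP.
rewrite -Pu; apply: (@le_trans _ _ (d%:R * (Q * (k%:R * (rm / m%:R))))).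
  apply: enorm_le_sup => c; rewrite !mxE.
  rewrite (le_trans (chart_lipschitz sInv (cb j) Q0 Bu vu c)) // ler_wpM2l ?(ltW Q0) //.
  rewrite (le_trans (ler_sum _ (fun l _ => vd l))) //.
  by rewrite sumr_const card_ord -[leLHS]mulr_natl.
rewrite ler_pdivlMr // (_ : _ * m%:R = d%:R * (Q * (k%:R * rm))); first by rewrite lerDl.
by field; rewrite lt0r_neq0.
Qed.

(** * Eigenvalue decay and effective dimension *)

Lemma gaussian_mx_spectrum (R : realType) d n eta (x : 'I_n -> 'rV[R]_d) : 0 <= eta ->
  exists (P : 'M[R[i]]_n) (s : 'I_n -> R),
    [/\ P \is unitarymx,
        map_mx (real_complex R) (gaussian_mx eta x) =
          P^t* *m diag_mx (\row_i real_complex R (s i)) *m P,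
        char_poly (gaussian_mx eta x) = \prod_i ('X - (s i)%:P) & forall i, 0 <= s i].
Proof.
move=> eta0.
have sym : (gaussian_mx eta x)^T = gaussian_mx eta x.
  by apply/matrixP => i l; rewrite !mxE gaussian_sym.
have [P [s [uP AE cE]]] := symmetric_spectral sym.
exists P, s; split => //; apply: psd_roots_ge0 cE _ => a.
rewrite (le_trans (gaussian_psd a x eta0)) // le_eqVlt; apply/orP; left; apply/eqP.
by apply: eq_bigr => i _; congr (_ * _); apply: eq_bigr => j _; rewrite mxE.
Qed.

Lemma eig_gaussian_ge0 (R : realType) d n eta (x : 'I_n -> 'rV[R]_d) j :
  0 <= eta -> 0 <= eig (gaussian_mx eta x) j.
Proof.
move=> /(gaussian_mx_spectrum x)[P [s [_ _ /eigenvalues_perm pE s0]]]; rewrite /eig.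
have [jn|/(nth_default 0) -> //] := ltnP j.-1 (size (eigenvalues (gaussian_mx eta x))).
have := mem_nth 0 jn; rewrite (perm_mem pE) => /codomP[i ->]; exact: s0.
Qed.

(** K has trace n and nonnegative eigenvalues, so two of them cannot both exceed n / 2. This serves
    the small p, for which the net is too coarse; the factor 1/2 leaves room for a positive rate
    c. *)
Lemma eig_gaussian_half (R : realType) d n eta (x : 'I_n -> 'rV[R]_d) p :
  0 <= eta -> (0 < p)%N -> eig (gaussian_mx eta x) p.+1 <= n%:R / 2.
Proof.
move=> eta0 p0; have [P [s [_ _ cE s0]]] := gaussian_mx_spectrum x eta0.
apply: (eig_le_of_card cE); first by rewrite divr_ge0.
rewrite (leq_trans _ p0) // leqNgt; apply/negP => /card_gt1P[i [j [/= iI jI ij]]].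
have n0 : (0 < n)%N by rewrite (leq_ltn_trans _ (ltn_ord i)).
have := char_poly_trace_sum n0 cE.
have -> : \tr (gaussian_mx eta x) = n%:R.
  rewrite /mxtrace (eq_bigr (fun=> 1)) => [|l _]; last by rewrite mxE gaussian_diag.
  by rewrite sumr_const card_ord.
rewrite (bigD1 i) //= (bigD1 j) /= 1?eq_sym // => e.
have : 0 <= \sum_(l < n | (l != i) && (l != j)) s l by apply: sumr_ge0.
rewrite !inE in iI jI; lra.
Qed.

(** The interpolants of the rows of K factor through the q nodes and provide W and G for
    [low_rank_card]; the residuals form E. *)
Lemma eig_gaussian_low_rank (R : realType) d n q p eta (x : 'I_n -> 'rV[R]_d)
    (z : 'I_q -> 'rV[R]_d) (e : R) : 0 <= eta -> (q <= p)%N -> 0 <= e ->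
  (forall i j, `|gaussian eta (x i) (x j) -
     interpolant eta z (gaussian eta (x i)) (x j)| <= e) ->
  eig (gaussian_mx eta x) p.+1 <= n%:R * e.
Proof.
move=> eta0 qp e0 he; have [P [s [uP AE cE s0]]] := gaussian_mx_spectrum x eta0.
apply: (eig_le_of_card cE); first by rewrite mulr_ge0.
apply: leq_trans qp.
pose w i := invmx (gaussian_mx eta z) *m (\col_l gaussian eta (x i) (z l)).
apply: (@low_rank_card _ _ _ _ P s (\matrix_(i, l) w i l 0)
  (\matrix_(l, j) gaussian eta (x j) (z l))
  (\matrix_(i, j) (gaussian eta (x i) (x j) - interpolant eta z (gaussian eta (x i)) (x j)))
  e uP AE) => // [|i j]; last by rewrite mxE.
apply/matrixP => i j; rewrite !mxE.
rewrite (_ : \sum_l _ = interpolant eta z (gaussian eta (x i)) (x j)); last first.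
  by apply: eq_bigr => l _; rewrite !mxE.
by rewrite addrC subrK.
Qed.

Lemma powR_of_pow (R : realType) (y : R) k : (0 < k)%N -> 0 <= y ->
  (y `^ (k%:R^-1)) ^+ k = y.
Proof.
move=> k0 y0; rewrite -powR_mulrn ?powR_ge0 // -powRrM mulVf ?powRr1 //.
by rewrite pnatr_eq0 -lt0n.
Qed.

Lemma eig_decay (R : realType) (d k : nat) (rb : R) (Omega : set 'rV[R]_d)
    (T : nat) (U : 'I_T -> set 'rV[R]_d) (r : 'I_T -> R)
    (Psi : 'I_T -> 'rV[R]_d -> 'rV[R]_k) (Psi_inv : 'I_T -> 'rV[R]_k -> 'rV[R]_d)
    (Q eta : R) :
  (0 < k)%N -> Omega `<=` closed_eball rb -> compact Omega ->
  ball_atlas Omega U r Psi Psi_inv -> 0 < Q ->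
  (forall j, chart_bound (r j) Q (Psi_inv j)) -> 0 < eta ->
  exists2 c : R, 0 < c & forall n (x : 'I_n -> 'rV[R]_d), (forall i, Omega (x i)) ->
    forall p, (0 < p)%N ->
    eig (gaussian_mx eta x) p.+1 <= n%:R * expR (- c * p%:R `^ (2 / (5 * k%:R))).
Proof.
move=> k0 Orb cO atl Q0 cb eta0.
have [c0 [h0 [c0p h0p decay]]] := zeros_decay k0 Orb cO atl Q0 cb eta0.
have [C Cp net] := atlas_net atl Q0 cb.
have kp : 0 < k%:R :> R by rewrite ltr0n.
have [a aE] : exists a : R, a = 2 / (5 * k%:R) by eexists.
have ap : 0 < a by rewrite aE divr_gt0 // mulr_gt0.
rewrite -aE.
(* The net of parameter m >= 1 has at most T (2m + 1)^k <= D m^k points; T + 1 in place of T keeps D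
   positive. *)
have [D DE] : exists D : R, D = T.+1%:R * 3 ^+ k by eexists.
have Dp : 0 < D by rewrite DE mulr_gt0 ?ltr0n // exprn_gt0.
(* Above this threshold X = (p / D)^(1/k) yields m = floor X >= 1 and h = 2 C / X <= h0. *)
have [X0 X0E] : exists X0 : R, X0 = Num.max 1 (2 * C / h0) by eexists.
have X01 : 1 <= X0 by rewrite X0E le_max lexx.
have X0h : 2 * C / h0 <= X0 by rewrite X0E le_max lexx orbT.
have p0p : 0 < D * X0 ^+ k by rewrite mulr_gt0 // exprn_gt0 //; lra.
have [c1 c1E] : exists c1 : R, c1 = c0 * ((2 * C) `^ (- (2 / 5)) * D `^ (- a)) by eexists.
have c1p : 0 < c1 by rewrite c1E !mulr_gt0 ?powR_gt0 // mulr_gt0.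
(* Below the threshold p <= D X0^k, so c2 p^a <= 1/2 and exp (- c2 p^a) >= 1/2, which
   [eig_gaussian_half] matches. *)
have [c2 c2E] : exists c2 : R, c2 = 1 / (2 * (D * X0 ^+ k) `^ a) by eexists.
have c2p : 0 < c2 by rewrite c2E divr_gt0 // mulr_gt0 // powR_gt0.
exists (Num.min c1 c2); first by rewrite lt_min c1p.
move=> n x Ox p pp.
have pR : 0 < p%:R :> R by rewrite ltr0n.
have pa0 : 0 <= p%:R `^ a :> R by exact: powR_ge0.
pose X := (p%:R / D) `^ (k%:R^-1).
have pD0 : 0 <= p%:R / D by rewrite divr_ge0 // ltW.
have Xk : X ^+ k = p%:R / D by exact: powR_of_pow.
have X_ge0 : 0 <= X by exact: powR_ge0.
have [XX0|XX0] := ltP X X0.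
  rewrite (le_trans (eig_gaussian_half x (ltW eta0) pp)) // ler_wpM2l //.
  have h : p%:R <= D * X0 ^+ k.
    rewrite mulrC -ler_pdivrMr // -Xk lerXn2r ?nnegrE //; last exact: ltW.
    exact: le_trans ler01 X01.
  have h2 : p%:R `^ a <= (D * X0 ^+ k) `^ a.
    by rewrite ge0_ler_powR ?nnegrE ?(ltW ap) // ltW.
  have h3 : c2 * p%:R `^ a <= 1 / 2.
    rewrite c2E mulrAC mul1r ler_pdivrMr ?mulr_gt0 ?powR_gt0 //.
    by rewrite mulrA mul1r mulVf ?mul1r ?pnatr_eq0.
  have h4 : Num.min c1 c2 * p%:R `^ a <= c2 * p%:R `^ a.
    by rewrite ler_wpM2r // ge_min lexx orbT.
  by have := expR_ge1Dx (- Num.min c1 c2 * p%:R `^ a); rewrite mulNr; lra.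
have [m mE] : exists m, m = Num.truncn X by eexists.
have X1 : 1 <= X by exact: le_trans X01 XX0.
have m0 : (0 < m)%N by rewrite mE truncn_gt0.
have mX : m%:R <= X by rewrite mE truncn_le.
have Xm : X < m%:R + 1 by rewrite mE natr1 truncnS_gt.
have mp : 1 <= m%:R :> R by rewrite ler1n.
have [z [sz uz Oz dz]] := net m m0.
have szp : (size z <= p)%N.
  rewrite (leq_trans sz) // (@leq_trans (T.+1 * (3 * m) ^ k)) //.
    apply: leq_mul => //; rewrite leq_exp2r //; clear -m0; lia.
  rewrite -(ler_nat R) natrM natrX natrM exprMn mulrA -DE mulrC -ler_pdivlMr // -Xk.
  by rewrite lerXn2r ?nnegrE.
(* X < m + 1 <= 2 m gives C / m <= h. Working with X instead of its integer part makes h^(-2/5) an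
   exact multiple of p^a. *)
pose h := 2 * C / X.
have Xp : 0 < X by lra.
have hp : 0 < h by rewrite divr_gt0 // mulr_gt0.
have hh0 : h <= h0.
  by rewrite ler_pdivrMr // [leRHS]mulrC -ler_pdivrMr // (le_trans X0h).
have Cmh : C / m%:R <= h.
  rewrite ler_pdivrMr; last by lra.
  rewrite /h mulrAC ler_pdivlMr // -mulrA mulrCA ler_wpM2l ?(ltW Cp) //; lra.
pose zz (l : 'I_(size z)) := nth 0 z l.
have zzI : injective zz.
  by move=> l l' /eqP; rewrite nth_uniq // => /eqP/val_inj.
have Ozz l : Omega (zz l) by apply: Oz; rewrite mem_nth.
pose e := expR (- c0 * h `^ (- (2 / 5))).
have he i j : `|gaussian eta (x i) (x j) - interpolant eta zz (gaussian eta (x i)) (x j)| <= e.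
  rewrite -[leRHS]mulr1.
  apply: (decay h _ (fun y => gaussian eta (x i) y - interpolant eta zz (gaussian eta (x i)) y)) => //.
  - by rewrite hp.
  - exact: kernel_residual_bounded.
  move=> y Oy; have [w wz wy] := dz y Oy.
  have wl : (index w z < size z)%N by rewrite index_mem.
  have zw : zz (Ordinal wl) = w by rewrite /zz /= nth_index.
  exists w; split; [exact: Oz | by rewrite -zw interpolant_node // subrr | exact: le_trans wy Cmh].
rewrite (le_trans (eig_gaussian_low_rank (ltW eta0) szp (expR_ge0 _) he)) // ler_wpM2l //.
rewrite ler_expR !mulNr lerN2.
have -> : h `^ (- (2 / 5)) = (2 * C) `^ (- (2 / 5)) * (D `^ (- a) * p%:R `^ a).
  rewrite /h powRM ?invr_ge0 ?mulr_ge0 ?(ltW Cp) //; congr (_ * _).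
  rewrite -[X^-1]powR_inv1 // -powRrM mulN1r opprK /X -powRrM.
  have -> : k%:R^-1 * (2 / 5) = a by rewrite aE; field; rewrite lt0r_neq0.
  by rewrite powRM ?invr_ge0 ?(ltW Dp) // mulrC -[D^-1]powR_inv1 ?(ltW Dp) // -powRrM mulN1r.
have -> : c0 * ((2 * C) `^ (- (2 / 5)) * (D `^ (- a) * p%:R `^ a)) = c1 * p%:R `^ a.
  by rewrite c1E; ring.
by rewrite ler_wpM2r // ge_min lexx.
Qed.


Lemma sum_inv_sqr (R : realType) n : \sum_(i < n) (i.+1%:R ^+ 2)^-1 <= 2 :> R.
Proof.
suff : \sum_(i < n) (i.+1%:R ^+ 2)^-1 <= 2 - n%:R^-1 :> R.
  by move=> h; rewrite (le_trans h) // gerBl invr_ge0.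
elim: n => [|[|n] IH]; first by rewrite big_ord0 invr0 subr0.
  by rewrite big_ord1 expr1n invr1; lra.
rewrite big_ord_recr /= (le_trans (lerD IH (lexx _))) //.
have [y yE] : exists y : R, y = n.+1%:R by eexists.
have y1 : 1 <= y by rewrite yE ler1n.
rewrite -[n.+2%:R]natr1 -yE -subr_ge0.
have -> : 2 - (y + 1)^-1 - (2 - y^-1 + ((y + 1) ^+ 2)^-1) = (y * (y + 1) ^+ 2)^-1.
  by field; apply/andP; split; rewrite lt0r_neq0 //; lra.
by rewrite invr_ge0 mulr_ge0 ?sqr_ge0 //; lra.
Qed.

Lemma sum_ltn_le n M : (\sum_(0 <= p < n) (p < M) <= M)%N.
Proof.
rewrite (@leq_trans (minn n M)) ?geq_minr //.
elim: n => [|n IH]; first by rewrite big_geq.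
by rewrite big_nat_recr //= (leq_trans (leq_add IH (leqnn _))) //; case: (ltnP n M); lia.
Qed.

(* At most M + 1 terms, where M <= Y = (2/c ln (1/tau))^(5k/2), are bounded by 1;
   beyond them half of the decay absorbs 1/tau and the rest is O(1/p^2). *)
Lemma eff_dim_bound (R : realType) k n (lam : nat -> R) (c tau : R) : (0 < k)%N -> (0 < n)%N ->
  0 < c -> 0 < tau <= 1 -> (forall j, 0 <= lam j) ->
  (forall p, (0 < p)%N -> lam p.+1 <= n%:R * expR (- c * p%:R `^ (2 / (5 * k%:R)))) ->
  \sum_(1 <= j < n.+1) lam j / (lam j + tau * n%:R) <=
    (2 / c * ln (1 / tau)) `^ (5 * k%:R / 2) +
    (1 + 8 * ((5 * k)%:R / (c / 2)) ^+ (5 * k)).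
Proof.
move=> k0 n0 cp /andP[tp t1] l0 dec.
have kp : 0 < k%:R :> R by rewrite ltr0n.
have nR : 0 < n%:R :> R by rewrite ltr0n.
have [a aE] : exists a : R, a = 2 / (5 * k%:R) by eexists.
have ap : 0 < a by rewrite aE divr_gt0 // mulr_gt0.
rewrite -aE in dec.
have b0 : 0 <= ln (1 / tau) by rewrite ln_ge0 // ler_pdivlMr // mul1r.
have [b bE] : exists b, b = ln (1 / tau) by eexists.
rewrite -bE in b0 *.
have tE : tau^-1 = expR b by rewrite bE div1r lnK // posrE invr_gt0.
have cb0 : 0 <= 2 / c * b by rewrite mulr_ge0 // divr_ge0 // ltW.
have [Y YE] : exists Y, Y = (2 / c * b) `^ (5 * k%:R / 2) by eexists.
rewrite -YE; have Y0 : 0 <= Y by rewrite YE powR_ge0.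
have Ya : Y `^ a = 2 / c * b.
  rewrite YE -powRrM (_ : 5 * k%:R / 2 * a = 1) ?powRr1 //.
  by rewrite aE; field; rewrite lt0r_neq0.
(* q is chosen so that a q = 2: then exp (- y) <= (q / y)^q, a form of exp (y / q) >= y / q, turns y
   = (c / 2) p^a into G / p^2. *)
pose q := (5 * k)%N; have q0 : (0 < q)%N by rewrite muln_gt0.
have qR : 0 < q%:R :> R by rewrite ltr0n.
have [G GE] : exists G : R, G = (q%:R / (c / 2)) ^+ q by eexists.
rewrite -/q -GE.
have G0 : 0 <= G by rewrite GE exprn_ge0 // divr_ge0 // divr_ge0 // ltW.
pose M := Num.truncn Y.
have MY : M%:R <= Y by rewrite truncn_le.
have YM : Y < M.+1%:R by rewrite truncnS_gt.
have tn0 : 0 < tau * n%:R by rewrite mulr_gt0.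
(* The 4 replaces p^-2 by (p + 1)^-2 for p >= 1; with \sum (p + 1)^-2 <= 2 it becomes the 8 of the
   statement. *)
have term p : lam p.+1 / (lam p.+1 + tau * n%:R) <= (p < M.+1)%:R + 4 * G * (p.+1%:R ^+ 2)^-1.
  have lp : 0 < lam p.+1 + tau * n%:R by rewrite ltr_wpDl.
  have sq : 0 < p.+1%:R ^+ 2 :> R by rewrite exprn_gt0.
  have [pM|Mp] := ltnP p M.+1.
    apply: (@le_trans _ _ 1); first by rewrite ler_pdivrMr // mul1r lerDl ltW.
    by rewrite lerDl mulr_ge0 ?invr_ge0 ?(ltW sq) // mulr_ge0.
  rewrite add0r; have p0 : (0 < p)%N by exact: leq_trans Mp.
  have pR : 1 <= p%:R :> R by rewrite ler1n.
  have Yp : Y <= p%:R by rewrite (le_trans (ltW YM)) // ler_nat.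
  have pa : 2 / c * b <= p%:R `^ a by rewrite -Ya ge0_ler_powR ?nnegrE ?(ltW ap).
  have pa0 : 0 < p%:R `^ a :> R by rewrite powR_gt0 //; lra.
  have bp : b <= c / 2 * p%:R `^ a.
    by move: pa; rewrite -ler_pdivlMl ?divr_gt0 // invf_div.
  have y0 : 0 < c / 2 * p%:R `^ a by rewrite mulr_gt0 // divr_gt0.
  have paq : (p%:R `^ a) ^+ q = p%:R ^+ 2 :> R.
    rewrite -powR_mulrn ?(ltW pa0) // -powRrM (_ : a * q%:R = 2%:R) ?powR_mulrn //.
    by rewrite aE /q natrM; field; rewrite lt0r_neq0.
  apply: (@le_trans _ _ (expR (- (c / 2 * p%:R `^ a)))).
    apply: (@le_trans _ _ (lam p.+1 / (tau * n%:R))).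
      by rewrite ler_wpM2l // lef_pV2 ?posrE // lerDr.
    rewrite ler_pdivrMr // (le_trans (dec p p0)) //.
    have -> : expR (- c * p%:R `^ a) = expR (- (c / 2 * p%:R `^ a)) * expR (- (c / 2 * p%:R `^ a)).
      by rewrite -expRD; congr expR; field.
    rewrite [tau * _]mulrC [leRHS]mulrCA ler_wpM2l // ?(ltW nR) //.
    rewrite ler_wpM2l ?expR_ge0 // -[tau]invrK tE -expRN ler_expR; lra.
  apply: (@le_trans _ _ (G * (p%:R ^+ 2)^-1)).
    rewrite expRN GE -paq -exprVn -exprMn.
    have -> : c / 2 * p%:R `^ a = (c / 2 * p%:R `^ a / q%:R) * q%:R by rewrite divfK ?lt0r_neq0.
    rewrite expRM_natr -exprVn lerXn2r ?nnegrE ?invr_ge0 ?expR_ge0 //.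
      by rewrite mulr_ge0 ?invr_ge0 ?(ltW pa0) // divr_ge0 // divr_ge0 // ltW.
    rewrite -[leRHS]invrK lef_pV2 ?posrE ?expR_gt0 ?invr_gt0 //; last first.
      by rewrite mulr_gt0 ?invr_gt0 // divr_gt0 // divr_gt0.
    rewrite (le_trans _ (expR_ge1Dx _)) // (_ : (q%:R / (c / 2) * (p%:R `^ a)^-1)^-1 = c / 2 * p%:R `^ a / q%:R).
      by rewrite lerDr.
    by field; rewrite !lt0r_neq0.
  have p2 : 0 < p%:R ^+ 2 :> R by rewrite exprn_gt0 //; lra.
  rewrite [4 * G]mulrC -mulrA ler_wpM2l // ler_pdivlMr // mulrC ler_pdivrMr //.
  by rewrite -[p.+1%:R]natr1; nra.
rewrite big_add1 /= big_mkord.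
apply: (@le_trans _ _ (\sum_(p < n) ((p < M.+1)%:R + 4 * G * (p.+1%:R ^+ 2)^-1))).
  by apply: ler_sum => p _; exact: term.
rewrite big_split /=.
rewrite addrA lerD //.
  apply: (@le_trans _ _ M.+1%:R); last by rewrite -natr1 lerD2r.
  rewrite -natr_sum ler_nat -(big_mkord xpredT (fun p => (p < M.+1 : nat))).
  exact: sum_ltn_le.
rewrite -mulr_sumr; have := sum_inv_sqr R n; nra.
Qed.

Theorem theorem4 (R : realType) (d k : nat) (hk0 : (0 < k)%N) (hkd : (k < d)%N)
    (rho : R) (Omega : set 'rV[R]_d)
    (hball : Omega `<=` closed_eball rho)
    (hcompact : compact Omega)
    (hmanifold : smooth_manifold k Omega)
    (T : nat) (U : 'I_T -> set 'rV[R]_d) (r : 'I_T -> R)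
    (Psi : 'I_T -> 'rV[R]_d -> 'rV[R]_k)
    (Psi_inv : 'I_T -> 'rV[R]_k -> 'rV[R]_d)
    (hatlas : ball_atlas Omega U r Psi Psi_inv)
    (Q : R) (hQ : 0 < Q)
    (hbound : forall (alpha : {ffun 'I_k -> nat}) (j : 'I_T),
       (exists i, alpha i <> 0%N) ->
       (ereal_sup [set (enorm (mderive alpha (Psi_inv j) u))%:E
                  | u in open_eball (r j)] <= (Q ^+ mindex_size alpha)%:E)%E)
    (eta : R) (heta : 0 < eta) :
  (forall H : rkhs (@gaussian R d eta),
     exists c h : R, [/\ 0 < c, 0 < h &
       forall (n : nat) (x : 'I_n -> 'rV[R]_d),
         (0 < n)%N -> injective x -> (forall i, Omega (x i)) ->
         fill_distance (range x) Omega <= h ->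
         forall (f : 'rV[R]_d -> R) (y : 'rV[R]_d), car H f -> Omega y ->
           `|f y - interpolant eta x f y| <=
             expR (- c * fill_distance (range x) Omega `^ (- (2 / 5)))
             * rkhs_norm H f])
  /\
  (exists c : R, 0 < c /\
     forall (n : nat) (x : 'I_n -> 'rV[R]_d),
       (0 < n)%N -> injective x -> (forall i, Omega (x i)) ->
       forall p : nat, (1 <= p <= n)%N ->
         eig (gaussian_mx eta x) p.+1 <=
           n%:R * expR (- c * p%:R `^ (2 / (5 * k%:R))))
  /\
  (exists c1 c2 : R, 0 < c1 /\
     forall (n : nat) (x : 'I_n -> 'rV[R]_d),
       (0 < n)%N -> injective x -> (forall i, Omega (x i)) ->
       forall tau : R, 0 < tau <= 1 ->
         eff_dim (gaussian_mx eta x) tau <=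
           (c1 * ln (1 / tau)) `^ (5 * k%:R / 2) + c2).
Proof.
have cb j : chart_bound (r j) Q (Psi_inv j).
  by apply: chart_bound_of_mderive => alpha; exact: hbound.
have [c cp decay] := eig_decay hk0 hball hcompact hatlas hQ cb heta.
split; last split.
- move=> H; have [c0 [h0 [c0p h0p zd]]] := zeros_decay hk0 hball hcompact hatlas hQ cb heta.
  exists c0, h0; split => // n x n0 xI Ox fh f y Hf Oy.
  have dense := fill_distanceP n0 hball Ox.
  (* [zeros_decay] requires h > 0. At fill distance 0 every point of Omega is a node, and the
     interpolation error is 0. *)
  have := fill_distance_ge0 n0 hball Ox; rewrite le_eqVlt => /orP[/eqP f0|fp].
    have [i hi] := dense y Oy; move: hi; rewrite -f0 => /enorm_eq0/eqP; rewrite subr_eq0 => /eqP <-.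
    by rewrite interpolant_node // subrr normr0 mulr_ge0 ?expR_ge0 ?sqrtr_ge0.
  have fhp : 0 < fill_distance (range x) Omega <= h0 by rewrite fp.
  exact: interpolation_error heta xI Ox Hf (expR_ge0 _) (zd _ fhp) dense Oy.
- exists c; split => // n x _ _ Ox p /andP[p0 _]; exact: decay.
exists (2 / c), (1 + 8 * ((5 * k)%:R / (c / 2)) ^+ (5 * k)).
split; first by rewrite divr_gt0.
move=> n x n0 _ Ox tau tau1; apply: eff_dim_bound => // [j|p p0].
  by apply: eig_gaussian_ge0; exact: ltW.
exact: decay.
Qed.
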